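(* Let $\mathtt{Alg}$ be any sequential algorithm, $(n_k)_{k\ge0}$ any sequence of batch sizes, and $P\in\mathcal P(\Theta)$ a data-independent prior. For any $\lambda\in(0,1)$ and $\delta\in(0,1]$, with probability at least $1-\delta$ over $S$, the following holds simultaneously for all $k\ge0$ and all $Q\in\mathcal P(\Theta)$, where $\pi_{j+1}$ denotes the output of $\mathtt{Alg}$ at time $j$: $$R(\pi_Q)-\sum_{j=0}^k\frac{n_j}{N_k}R(\pi_j)\le\hat R^{\lambda\text{-}\mathrm{adj}}_{0:k}(\pi_Q)+\hat C_{0,k}(\lambda)+\frac{\operatorname{KL}(Q,P)+\log\frac1\delta}{\lambda N_k},$$ where $\hat C_{0,k}(\lambda)=\frac1{N_k}\sum_{j=0}^k\sum_{i\in I_j}\frac1\lambda\log\Big(\frac1{1+\lambda c_i}\Big)$.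
   Context: Contextual bandit: $\mathcal X\subset\mathbb R^d$ is a compact context space, $\mathcal A=\{1,\dots,K\}$ a finite action set, a policy $\pi$ maps each $x\in\mathcal X$ to a probability distribution $\pi(\cdot\mid x)$ on $\mathcal A$. Contexts have an unknown law $\nu$ on $\mathcal X$; given context $x$ and action $a$, the cost $c\in[-1,0]$ is drawn from an unknown law $p(\cdot\mid x,a)$ with mean $c(a,x)$. The risk of $\pi$ is $R(\pi)=\mathbb E_{x\sim\nu,\,a\sim\pi(\cdot\mid x)}[c(a,x)]$. Sequential data: $\pi_0$ is a fixed initial policy. At time $k\ge 0$ the current policy $\pi_k$ collects a batch $S_k=\{(x_i,a_i,c_i): i\in I_k\}$, $|I_k|=n_k$ (positive integers), with the index sets $I_k$ disjoint; $N_k=\sum_{j=0}^k n_j$; $\mathcal F_k$ is the $\sigma$-algebra generated by $S_0,\dots,S_k$ ($\mathcal F_{-1}$ trivial), and $S=\bigcup_k S_k$. Conditionally on $\mathcal F_{k-1}$, the triples in $S_k$ are mutually independent with $x_i\sim\nu$, $a_i\sim\pi_k(\cdot\mid x_i)$, $c_i\sim p(\cdot\mid x_i,a_i)$. A sequential algorithm is one whose output $\pi_{k+1}$ at time $k$ is $\mathcal F_k$-measurable (a function of $S_0\cup\dots\cup S_k$); $\pi_{k+1}$ then collects $S_{k+1}$. Policy parametrization: $\Theta$ is a parameter space, $f_\theta:\mathcal X\to\mathcal A$ for $\theta\in\Theta$ are predictors, $\mathcal P(\Theta)$ is the set of probability distributions on $\Theta$; for $Q\in\mathcal P(\Theta)$,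 $\pi_Q(a\mid x)=\mathbb E_{\theta\sim Q}[\mathbf 1\{f_\theta(x)=a\}]$. $\operatorname{KL}(Q,P)=\mathbb E_Q[\log(dQ/dP)]$ is the Kullback–Leibler divergence ($+\infty$ if $Q\not\ll P$). Adjusted logarithmic smoothing estimator: $$\hat R^{\lambda\text{-}\mathrm{adj}}_{0:k}(\pi)=-\frac1{N_k}\sum_{j=0}^k\sum_{i\in I_j}\frac{\pi(a_i\mid x_i)}{\lambda}\log\Big(1-\frac{\lambda c_i}{\pi_j(a_i\mid x_i)(1+\lambda c_i)}\Big).$$ *)

(* Defs.v *)
From HB Require Import structures.
From mathcomp Require Import all_boot all_order all_algebra.
From mathcomp Require Import all_classical all_reals all_analysis.

Set Implicit Arguments.
Unset Strict Implicit.
Unset Printing Implicit Defensive.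

Import Order.TTheory GRing.Theory Num.Theory.
Import numFieldNormedType.Exports.

Local Open Scope classical_set_scope.
Local Open Scope ring_scope.

(* 'I_K.+1 is the action set: measurable types must be pointed, so the finite
   set of actions is numbered by 0, ..., K. *)
HB.instance Definition _ (K : nat) := isPointed.Build 'I_K.+1 ord0.
HB.instance Definition _ (K : nat) :=
  @isMeasurable.Build default_measure_display 'I_K.+1
    (@discrete_measurable 'I_K.+1) (@discrete_measurable0 'I_K.+1)
    (@discrete_measurableC 'I_K.+1) (@discrete_measurableU 'I_K.+1).

(* The subset X of R^d as a type, with the subspace topology.  Nonemptiness of
   X is only there because MathComp-Analysis asks measurable types to be
   pointed; it is forced anyway by the existence of a probability on X. *)
Definition subspace_type {R : realType} {d : nat} {X : set 'rV[R]_d}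
  (X0 : X !=set0) : Type := set_type X.

Section subspace_type_instances.
Context {R : realType} {d : nat} {X : set 'rV[R]_d} (X0 : X !=set0).

HB.instance Definition _ :=
  Topological.copy (subspace_type X0) (set_type X).
HB.instance Definition _ := isPointed.Build (subspace_type X0)
  (exist _ (projT1 (cid X0)) (mem_set (projT2 (cid X0)))).

End subspace_type_instances.

Notation context X0 := (g_sigma_algebraType (@open (subspace_type X0))).

Section kullback_leibler.
Local Open Scope ereal_scope.
Local Open Scope charge_scope.

Definition KL {R : realType} {d} {T : measurableType d}
    (Q P : probability T R) : \bar R :=
  if `[< Q `<< P >]
  then \int[Q]_t lne (('d (charge_of_finite_measure Q) '/d P) t)
  else +oo.

End kullback_leibler.

Section bandit.
Context {R : realType} {dX : measure_display} {X : measurableType dX}.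
Context {K : nat}.
Local Notation action := 'I_K.+1.

(* pi x a is the probability pi(a | x). *)
Definition policy : Type := X -> action -> R.

Definition policy_of (pi : R.-pker X ~> action) : policy :=
  fun x a => fine (pi x [set a]).

Definition mean_cost (p : R.-pker (X * action) ~> R) (a : action) (x : X) : R :=
  \int[p (x, a)]_c c.

Definition risk (nu : probability X R) (p : R.-pker (X * action) ~> R)
    (pi : policy) : R :=
  \int[nu]_x \sum_(a : action) pi x a * mean_cost p a x.

(* Law of (x, a, c) when x ~ nu, a ~ pi(. | x) and c ~ p(. | x, a). *)
Definition triple_law (nu : probability X R) (p : R.-pker (X * action) ~> R)
    (pi : policy) (B : set (X * action * R)) : \bar R :=
  (\int[nu]_x \sum_(a : action)
     (pi x a)%:E * p (x, a) [set c | B (x, a, c)])%E.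

Definition predictor_policy {dT} {Theta : measurableType dT}
    (f : Theta -> X -> action) (Q : probability Theta R) : policy :=
  fun x a => \int[Q]_t (f t x == a)%:R.

(* The samples of all batches are numbered consecutively: batch k is
   I_k = { i | batch_start n k <= i < batch_start n k.+1 }, so that
   N_k = n 0 + ... + n k = batch_start n k.+1. *)
Definition batch_start (n : nat -> nat) (k : nat) : nat :=
  \sum_(j < k) n j.

(* Alg k is the output at time k: a policy (a probability kernel from contexts
   to actions) depending measurably on S_0, ..., S_k. *)
Definition sequential_algorithm (n : nat -> nat) : Type :=
  forall k, R.-pker
    ((batch_start n k.+1).-tuple (X * action * R)%type * X) ~> action.

Context {dO : measure_display} {Omega : measurableType dO}.
Variables (n : nat -> nat) (Z : nat -> Omega -> X * action * R).

(* S_0, ..., S_(k-1) *)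
Definition past_data (k : nat) (w : Omega) :
    (batch_start n k).-tuple (X * action * R) :=
  [tuple Z i w | i < batch_start n k].

(* F_(k-1), the sigma-algebra generated by S_0, ..., S_(k-1) *)
Definition past_sigma_algebra (k : nat) : set (set Omega) :=
  g_sigma_algebra_preimage (past_data k).

(* pi_k, as a function of the realization of the data *)
Definition behavior_policy (pi0 : R.-pker X ~> action)
    (Alg : sequential_algorithm n) (k : nat) (w : Omega) : policy :=
  match k with
  | 0 => policy_of pi0
  | j.+1 => fun x a => fine (Alg j (past_data j.+1 w, x) [set a])
  end.

(* Conditionally on F_(k-1), the triples of batch k are independent with law
   triple_law nu p pi_k: the joint conditional law is characterized by
   integrating over the events of F_(k-1). *)
Definition sequential_sampling (Pr : probability Omega R)
    (nu : probability X R) (p : R.-pker (X * action) ~> R)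
    (pi : nat -> Omega -> policy) : Prop :=
  forall (k : nat) (B : set Omega) (A : nat -> set (X * action * R)),
    past_sigma_algebra k B -> (forall i, measurable (A i)) ->
    (Pr (B `&` \bigcap_(i in [set i | batch_start n k <= i
                                      < batch_start n k.+1]%N)
           (Z i @^-1` A i)) =
     \int[Pr]_(w in B)
       (\prod_(batch_start n k <= i < batch_start n k.+1)
          fine (triple_law nu p (pi k w) (A i)))%:E)%E.

(* pi_j(a_i | x_i) and 1 + lambda c_i are almost surely positive (for
   0 < lambda < 1), so the convention r / 0 = 0 plays no role. *)
Definition adj_ls_risk (pi_ : nat -> Omega -> policy) (lambda : R) (k : nat)
    (w : Omega) (pi : policy) : R :=
  - ((batch_start n k.+1)%:R^-1 *
     \sum_(j < k.+1) \sum_(batch_start n j <= i < batch_start n j.+1)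
       let: (x, a, c) := Z i w in
       pi x a / lambda *
       ln (1 - lambda * c / (pi_ j w x a * (1 + lambda * c)))).

Definition adj_correction (lambda : R) (k : nat) (w : Omega) : R :=
  (batch_start n k.+1)%:R^-1 *
  \sum_(j < k.+1) \sum_(batch_start n j <= i < batch_start n j.+1)
    lambda^-1 * ln (1 + lambda * (Z i w).2)^-1.

End bandit.

Arguments policy {R dX} X K.
Arguments sequential_algorithm R {dX} X K n.

(* Main.v *)
(* For a fixed predictor f_t write, for the i-th sample (x, a, c) collected by
   pi_k, X_i(t) = lambda (R(f_t) - R(pi_k)) + u ln(1 - lambda c / (pi_k(a|x) (1 + lambda c)))
   - ln(1 / (1 + lambda c)), with u = 1{f_t(x) = a}.  Since u is 0 or 1, the last
   two terms have exponential 1 + lambda c - lambda c u / pi_k(a|x), whose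
   conditional mean is at most 1 + lambda (R(pi_k) - R(f_t)); hence exp X_i(t) has
   conditional mean at most 1, exp (X_0(t) + ... + X_(i-1)(t)) is a nonnegative
   supermartingale in i, and so is its mixture over t ~ P.  Ville's inequality
   bounds the mixture by 1/delta at all times simultaneously, and the
   Donsker-Varadhan inequality passes from P to an arbitrary Q. *)
Require Import Defs.
From HB Require Import structures.
From mathcomp Require Import all_boot all_order all_algebra.
From mathcomp Require Import all_classical all_reals all_analysis.
From mathcomp Require Import measurable_realfun.
From mathcomp Require Import ring lra.

Set Implicit Arguments.
Unset Strict Implicit.
Unset Printing Implicit Defensive.

Import Order.TTheory GRing.Theory Num.Theory.
Import numFieldNormedType.Exports.

Local Open Scope classical_set_scope.
Local Open Scope ring_scope.

(** The sampling hypothesis describes a whole batch at once, against events that precede the batch,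
    while the supermartingale moves one sample at a time; [sampling_rect] bridges this gap.
    Conditional expectations are never formed: the past of sample i is [Omega] with a coarser
    sigma-algebra, [history Z i], and conditional laws are kernels from it. The identities behind
    them are proved on cylinders and extended by a pi-lambda argument to all nonnegative functions
    of the past and the new sample. The good event is built from the prior [P] alone, before any Q
    appears, which makes the bound uniform in Q. It ends up being a bound for the policy of Q, not
    just an average over t, because risk and adjusted estimator are both linear in the policy:
    factoring 1 + lambda c out of 1 + lambda c - lambda c u / q makes the logarithm affine in u on
    {0, 1}. *)

Lemma measurable_fun_inv d (T : measurableType d) (R : realType) (f : T -> R) :
  measurable_fun setT f -> measurable_fun setT (fun x => (f x)^-1).
Proof.
(* Inversion is continuous only off 0; at 0 the convention 0^-1 = 0 supplies the other branch of the
   case split. *)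
move=> mf; rewrite (_ : (fun x => _) = fun x => if f x == 0 then 0 else (f x)^-1).
  apply: measurable_fun_if => //; first exact: measurable_fun_eqr.
  apply: (@measurable_comp _ _ _ _ _ _ [set r : R | r != 0%R]).
  - exact: open_measurable.
  - by move=> /= _ [x [_ /negbT fx0] <-].
  - apply: open_continuous_measurable_fun => //; apply/in_setP => x /= x0.
    exact: inv_continuous.
  - exact: measurable_funS mf.
by apply/funext => x; case: eqP => // ->; rewrite invr0.
Qed.

(** * The Donsker-Varadhan inequality *)

Section integral_lemmas.
Context d (T : measurableType d) (R : realType).
Variable mu : {measure set T -> \bar R}.
Local Open Scope ereal_scope.

(** Positive and negative parts are compared separately, so no integrability is asked of [v]: in the
    application it is the logarithm of a density, whose integral may be infinite. *)
Lemma le_integral_ae (u v : T -> \bar R) :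
  measurable_fun setT u -> measurable_fun setT v ->
  {ae mu, forall x, u x <= v x} -> \int[mu]_x u x <= \int[mu]_x v x.
Proof.
move=> mu_ mv uv; rewrite integralE [leRHS]integralE leeB//.
- apply: ae_ge0_le_integral => //; [exact: measurable_funepos..|].
  apply: filterS uv => x uvx _.
  by rewrite !funeposE ge_max !le_max uvx lexx orbT.
- apply: ae_ge0_le_integral => //; [exact: measurable_funeneg..|].
  apply: filterS uv => x uvx _.
  by rewrite !funenegE ge_max !le_max leeN2 uvx lexx orbT.
Qed.

Lemma measurable_fun_lne (f : T -> \bar R) :
  measurable_fun setT f -> measurable_fun setT (fun x => lne (f x)).
Proof.
move=> mf; rewrite (_ : (fun x => _) = fun x => if f x <= 0 then -oo else
    if f x == +oo then +oo else (ln (fine (f x)))%:E); last first.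
  apply/funext => x; case: (f x) => [r| |] //=.
  by rewrite leNye.
apply: measurable_fun_ifT => //.
  exact: measurable_fun_lee.
apply: measurable_fun_ifT => //.
  exact: measurable_fun_eqe.
by apply/measurable_EFinP; apply: measurableT_comp => //; exact: measurableT_comp.
Qed.

End integral_lemmas.

Section donsker_varadhan.
Context d (T : measurableType d) (R : realType) (P Q : probability T R).
Local Open Scope ereal_scope.

Local Notation rn := (Radon_Nikodym_SigmaFinite.f Q P).

(** The Q-mass of the zero set of the density is the P-integral of the density over that set, that
    is, of 0. *)
Lemma ae_rn_gt0 : Q `<< P -> {ae Q, forall x, (0 < fine (rn x))%R}.
Proof.
move=> QP.
have mrn : measurable_fun setT rn.
  exact: measurable_int (Radon_Nikodym_SigmaFinite.f_integrable QP).
have m0 : measurable [set x | rn x = 0].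
  by have := mrn measurableT _ (emeasurable_set1 0); rewrite setTI.
exists [set x | rn x = 0]; split => //.
  rewrite (Radon_Nikodym_SigmaFinite.f_integral QP)//.
  by apply: integral0_eq => x.
move=> x /=; apply: contra_notP => rnx0; rewrite fine_gt0//.
rewrite lt0e Radon_Nikodym_SigmaFinite.f_ge0// andbT.
rewrite ltey_eq Radon_Nikodym_SigmaFinite.f_fin_num// andbT.
exact/eqP.
Qed.

(* With g = dQ/dP, integrate h + 1 - e^h / g <= ln g against Q. *)
Lemma donsker_varadhan (h : T -> R) : measurable_fun setT h ->
  Q.-integrable setT (EFin \o h) ->
  \int[P]_x (expR (h x))%:E <= 1 -> \int[Q]_x (h x)%:E <= KL Q P.
Proof.
move=> mh ih Ph; rewrite /KL; case: asboolP => [QP|_]; last exact: leey.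
have mrn : measurable_fun setT rn.
  exact: measurable_int (Radon_Nikodym_SigmaFinite.f_integrable QP).
pose g x := fine (rn x).
have mg : measurable_fun setT g by exact: measurableT_comp.
have rnE x : rn x = (g x)%:E.
  by rewrite fineK// Radon_Nikodym_SigmaFinite.f_fin_num.
have g0 x : (0 <= g x)%R by rewrite fine_ge0// Radon_Nikodym_SigmaFinite.f_ge0.
pose F x := (expR (h x) / g x)%R.
have F0 x : (0 <= F x)%R by rewrite divr_ge0// expR_ge0.
have mF : measurable_fun setT F.
  apply: measurable_funM; first exact: measurableT_comp.
  exact: measurable_fun_inv.
(* Passing from Q to P multiplies by g, which cancels the division; where g = 0 the product is 0, so
   only an inequality remains. *)
have F1 : \int[Q]_x (F x)%:E <= 1.
  rewrite -(Radon_Nikodym_SigmaFinite.change_of_variables QP)//; last 1 first.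
    exact/measurable_EFinP.
  apply: le_trans Ph; apply: ge0_le_integral => //.
  - by move=> x _; rewrite rnE -EFinM lee_fin mulr_ge0.
  - by apply: emeasurable_funM => //; exact/measurable_EFinP.
  - exact/measurable_EFinP/measurableT_comp.
  - move=> x _; rewrite rnE -EFinM lee_fin /F.
    have [->|gx0] := eqVneq (g x) 0%R; first by rewrite mulr0 expR_ge0.
    by rewrite mulfVK.
have iF : Q.-integrable setT (EFin \o F).
  apply/integrableP; split; first exact/measurable_EFinP.
  under eq_integral => x _ do rewrite /= ger0_norm//.
  by rewrite (le_lt_trans F1)// ltry.
have i1 : Q.-integrable setT (EFin \o cst (1:R)%R).
  exact: finite_measure_integrable_cst.
(* Adding 1 - F can only increase the integral, by [F1]. *)
apply: (@le_trans _ _ (\int[Q]_x (h x + 1 - F x)%:E)).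
  have -> : \int[Q]_x (h x + 1 - F x)%:E =
      \int[Q]_x (h x)%:E + 1 - \int[Q]_x (F x)%:E.
    under eq_integral => x _ do rewrite EFinB EFinD.
    rewrite integralB//=; last exact: (integrableD measurableT ih i1).
    rewrite integralD//=.
    by rewrite integral_cst// mul1e; congr (_ + _ - _); exact: probability_setT.
  have Ffin : \int[Q]_x (F x)%:E \is a fin_num by exact: integrable_fin_num.
  rewrite leeBrDr// leeD2l//.
have aeg := ae_rn_gt0 QP.
(* [KL] uses the derivative of a charge, whereas the change of variables uses the one for
   sigma-finite measures; they agree P-almost everywhere, hence Q-almost everywhere. *)
have aeQ : ae_eq Q setT rn (Radon_Nikodym (charge_of_finite_measure Q) P).
  apply: (null_dominates_ae_eq measurableT QP).
  exact: ae_eq_Radon_Nikodym_SigmaFinite.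
apply: le_integral_ae.
- apply/measurable_EFinP; apply: measurable_funB => //.
  exact: measurable_funD.
- apply: measurable_fun_lne; apply: measurable_int; apply: Radon_Nikodym_integrable; exact: QP.
- apply: filterS2 aeg aeQ => x gx0 /(_ I) <-; rewrite rnE lne_EFin// lee_fin.
  (* This is 1 + y <= e^y at y = h - ln g. *)
  rewrite lerBlDr -lerBlDl.
  rewrite addrAC addrC; apply: le_trans (expR_ge1Dx _) _.
  by rewrite expRB lnK ?posrE.
Qed.

End donsker_varadhan.

(** * Disintegration along a kernel *)

Section image_measure.
Context d1 d2 (T1 : measurableType d1) (T2 : measurableType d2) (R : realType).

Definition image_measure (m : {measure set T1 -> \bar R}) (f : T1 -> T2)
    (mf : measurable_fun setT f) : {measure set T2 -> \bar R} :=
  measure_function_pushforward__canonical__measure_function_Measure m mf.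

End image_measure.

Section product_measure_uniqueness.
Context dG dT (G : measurableType dG) (T : measurableType dT) (R : realType).
Variables (C : set (set G)) (m1 m2 : {measure set (G * T) -> \bar R}).
Hypotheses (mC : measurable = <<s C >>) (CI : setI_closed C) (CT : C setT).
Hypothesis m1oo : (m1 setT < +oo)%E.
Hypothesis m12 : forall A B, C A -> measurable B -> m1 (A `*` B) = m2 (A `*` B).

(** Uniqueness of measures is applied twice: with B fixed, to the slices A |-> m (A x B) on G, going
    from C to all measurable A; then on the product, going from rectangles to all measurable
    sets. *)
Lemma eq_measure_prod_generator E : measurable E -> m1 E = m2 E.
Proof.
have fin (m : {measure set (G * T) -> \bar R}) F : (m setT < +oo)%E ->
    measurable F -> (m F < +oo)%E.
  by move=> mT mF; apply: le_lt_trans mT; rewrite le_measure ?inE.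
have sub : C `<=` measurable by rewrite mC; exact: sub_sigma_algebra.
have rect A B : measurable A -> measurable B -> m1 (A `*` B) = m2 (A `*` B).
  move=> mA mB; have mTB : measurable ([set: G] `*` B) by exact: measurableX.
  pose n (m : {measure set (G * T) -> \bar R}) : {measure set G -> \bar R} :=
    
    image_measure (mrestr m mTB) (@measurable_fst _ _ G T).
  have nE (m : {measure set (G * T) -> \bar R}) F : n m F = m (F `*` B).
    rewrite /n /= /pushforward /mrestr; congr (m _).
    by apply/seteqP; split => -[x y] [] //= ? [].
  rewrite -!nE; apply: (measure_unique C (fun=> setT)) => //.
  - by rewrite bigcup_const.
  - by move=> F CF; rewrite !nE; exact: m12.
  - by move=> k; rewrite nE; apply: fin => //; exact: measurableX.
apply: (measure_unique [set A `*` B | A in measurable & B in measurable]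
  (fun=> setT)).
- exact: measurable_prod_measurableType.
- move=> _ _ [A1 mA1 [B1 mB1 <-]] [A2 mA2 [B2 mB2 <-]].
  exists (A1 `&` A2); first exact: measurableI.
  by exists (B1 `&` B2); [exact: measurableI|rewrite setXI].
- by move=> _; exists setT => //; exists setT => //; rewrite setXTT.
- by rewrite bigcup_const.
- by move=> _ [A mA [B mB <-]]; exact: rect.
- by [].
Qed.

End product_measure_uniqueness.

Section kernel_precomposition.
Context dX dY dZ (X : measurableType dX) (Y : measurableType dY)
  (Z : measurableType dZ) (R : realType).
Variables (k : R.-pker Y ~> Z) (g : X -> Y).

(** The proof [mg] is part of the term so that the kernel instances below can be inferred from
    it. *)
Definition kpreimage (mg : measurable_fun setT g) (x : X) :
  {measure set Z -> \bar R} := k (g x).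

Hypothesis mg : measurable_fun setT g.

Let measurable_kpreimage U : measurable U ->
  measurable_fun setT (kpreimage mg ^~ U).
Proof.
move=> mU; apply: (@measurableT_comp _ _ _ _ _ _ (k ^~ U) _ g) => //.
exact: measurable_kernel.
Qed.

HB.instance Definition _ := isKernel.Build _ _ _ _ _ (kpreimage mg)
  measurable_kpreimage.

Let kpreimage_prob x : kpreimage mg x setT = 1%E.
Proof. exact: prob_kernel. Qed.

HB.instance Definition _ := Kernel_isProbability.Build _ _ _ _ _
  (kpreimage mg) kpreimage_prob.

End kernel_precomposition.

Section kernel_probability.
Context dX dY (X : measurableType dX) (Y : measurableType dY) (R : realType).
Variables (k : R.-pker X ~> Y) (x : X).

(** An alias under which a single fibre of a kernel is recognised as a probability, for finiteness
    and Tonelli. *)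
Definition kernel_probability : set Y -> \bar R := k x.

HB.instance Definition _ := isMeasure.Build _ _ _ kernel_probability
  (measure0 (k x)) (measure_ge0 (k x)) (@measure_semi_sigma_additive _ _ _ (k x)).
HB.instance Definition _ := Measure_isProbability.Build _ _ _
  kernel_probability (prob_kernel x).

Lemma fin_num_kernel A : measurable A -> k x A \is a fin_num.
Proof. exact: (fin_num_measure kernel_probability). Qed.

End kernel_probability.

Section disintegration.
Context dW dG dT (W : measurableType dW) (G : measurableType dG)
  (T : measurableType dT) (R : realType).
Variables (Pr : probability W R) (iota : W -> G) (zeta : W -> T)
  (kappa : R.-pker G ~> T) (C : set (set G)).
Hypotheses (miota : measurable_fun setT iota) (mzeta : measurable_fun setT zeta).
Hypotheses (mC : measurable = <<s C >>) (CI : setI_closed C) (CT : C setT).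
Local Open Scope ereal_scope.
Hypothesis rect : forall A B, C A -> measurable B ->
  Pr (iota @^-1` A `&` zeta @^-1` B) =
  \int[Pr]_(w in iota @^-1` A) kappa (iota w) B.

Let mpair : measurable_fun setT (fun w => (iota w, zeta w)).
Proof. exact: measurable_fun_pair. Qed.

Let miota_snd : measurable_fun setT (fun x : unit * W => iota x.2).
Proof. exact: measurableT_comp. Qed.

Let mjoin : measurable_fun setT (fun x : unit * W * T => (iota x.1.2, x.2)).
Proof.
apply: measurable_fun_pair => //; apply: measurableT_comp => //.
exact: measurableT_comp.
Qed.

(** [Pr] as a kernel from a point, so that the joint law below is a composition of kernels. *)
Let prior : R.-pker unit ~> W :=
  kprobability (measurable_cst (Pr : pprobability W R)).
Let fiber : R.-sfker (unit * W) ~> (G * T)%type :=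
  (kpreimage kappa miota_snd \; kdirac mjoin).

(** The law of the pair (iota, zeta) coincides with the law obtained by drawing w from [Pr] and then
    z from [kappa (iota w)], since both agree on products of a set of C and a measurable set. This
    plays the role of conditioning on iota. *)
Lemma integral_disintegration (g : (G * T)%type -> \bar R) :
  (forall x, 0 <= g x) -> measurable_fun setT g ->
  \int[Pr]_w g (iota w, zeta w) =
  \int[Pr]_w \int[kappa (iota w)]_z g (iota w, z).
Proof.
move=> g0 mg.
have joint (h : (G * T)%type -> \bar R) : (forall x, 0 <= h x) ->
    measurable_fun setT h -> \int[kcomp prior fiber tt]_x h x =
    \int[Pr]_w \int[kappa (iota w)]_z h (iota w, z).
  move=> h0 mh; rewrite integral_kcomp//; apply: eq_integral => w _.
  rewrite integral_kcomp//; apply: eq_integral => z _.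
  by rewrite integral_dirac// diracT mul1e.
rewrite -joint//.
have -> : \int[Pr]_w g (iota w, zeta w) =
    \int[image_measure Pr mpair]_x g x.
  by rewrite [RHS]ge0_integral_pushforward.
apply: eq_measure_integral => E mE _.
apply: (eq_measure_prod_generator mC) => //.
  rewrite /image_measure /= /pushforward preimage_setT.
  by rewrite (@probability_setT _ _ _ Pr) ltry.
move=> A B CA mB.
have mA : measurable A by rewrite mC; exact: sub_sigma_algebra.
have miA : measurable (iota @^-1` A).
  by rewrite -[X in measurable X]setTI; exact: miota.
transitivity (\int[kcomp prior fiber tt]_x (\1_(A `*` B) x)%:E); last first.
  by rewrite integral_indic ?setIT//; exact: measurableX.
rewrite joint//; last first.
  apply/measurable_EFinP; apply: measurable_indic; exact: measurableX.
rewrite /image_measure /= /pushforward.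
have -> : (fun w => (iota w, zeta w)) @^-1` (A `*` B) =
  iota @^-1` A `&` zeta @^-1` B by [].
rewrite rect// integral_mkcond; apply: eq_integral => w _.
rewrite patchE; case: ifPn => wA.
  under eq_integral => z _.
    rewrite indicE in_setX/=.
    have -> : iota w \in A by move: wA; rewrite !inE.
    rewrite andTb -indicE; over.
  by rewrite integral_indic// setIT.
rewrite integral0_eq// => z _; rewrite indicE in_setX/=.
by have /negbTE -> : iota w \notin A by move: wA; rewrite !notin_setE.
Qed.

End disintegration.

(** * Ville's inequality for mixtures *)

Section maximal_inequality.
Context dW (W : measurableType dW) (R : realType) (Pr : probability W R).
Variables (V : nat -> W -> \bar R) (a : R).
Local Open Scope ereal_scope.
Hypotheses (a0 : (0 < a)%R) (V0 : forall i w, 0 <= V i w)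
  (mV : forall i, measurable_fun setT (V i)).

Definition below (i : nat) : set W :=
  [set w | forall l, (l <= i)%N -> V l w <= a%:E].

Hypothesis V0_le1 : \int[Pr]_w V 0 w <= 1.
Hypothesis V_super : forall i,
  \int[Pr]_(w in below i) V i.+1 w <= \int[Pr]_(w in below i) V i w.

Let measurable_le i : measurable [set w | V i w <= a%:E].
Proof. by rewrite -[X in measurable X]setTI; exact: emeasurable_fun_infty_c. Qed.

Let measurable_below i : measurable (below i).
Proof.
have -> : below i = \bigcap_(l in `I_i.+1) [set w | V l w <= a%:E].
  by apply/seteqP; split => w wi l; exact: wi.
by apply: fin_bigcap_measurable.
Qed.

Let belowS i : below i.+1 = below i `&` [set w | V i.+1 w <= a%:E].
Proof.
apply/seteqP; split => [w wi|w [wi wSi] l].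
  by split=> [l li|]; apply: wi => //; exact: leqW.
by rewrite leq_eqVlt => /predU1P[->//|]; rewrite ltnS; exact: wi.
Qed.

(** Markov's inequality, keeping the integral over the part below [a] that the induction on time
    needs. *)
Let markov_on (D : set W) i : measurable D ->
  a%:E * Pr (D `&` ~` [set w | V i w <= a%:E]) +
    \int[Pr]_(w in D `&` [set w | V i w <= a%:E]) V i w <=
  \int[Pr]_(w in D) V i w.
Proof.
move=> mD; have mU : measurable (D `&` ~` [set w | V i w <= a%:E]).
  by apply: measurableI => //; exact: measurableC.
have mL : measurable (D `&` [set w | V i w <= a%:E]) by exact: measurableI.
rewrite -[in leRHS](setIT D) -(setvU [set w | V i w <= a%:E]) setIUr.
rewrite ge0_integral_setU//; last 2 first.
  exact: measurable_funTS.
  by apply/disj_setPS => w [[_ +] [_]].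
rewrite leeD2r// -integral_cst//; apply: ge0_le_integral => //.
- by move=> w _; rewrite lee_fin ltW.
- exact: measurable_funTS.
- by move=> w [_] /negP; rewrite -ltNge => /ltW.
Qed.

(** Optional stopping at the first passage above [a], capped at time i: on the paths that have
    crossed, the stopped value is lowered to [a]; on the others it is [V i]. *)
Let below_bound i :
  a%:E * Pr (~` below i) + \int[Pr]_(w in below i) V i w <= 1.
Proof.
elim: i => [|i IH].
  apply: le_trans V0_le1; have := @markov_on setT 0 measurableT.
  rewrite !setTI; suff -> : below 0 = [set w | V 0 w <= a%:E] by [].
  apply/seteqP; split => [w|w w0 l]; first exact.
  by rewrite leqn0 => /eqP ->.
have mU : measurable (below i `&` ~` [set w | V i.+1 w <= a%:E]).
  by apply: measurableI => //; exact: measurableC.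
apply: le_trans IH.
apply: le_trans (leeD2l _ (V_super i)).
apply: le_trans (leeD2l _ (markov_on i.+1 (measurable_below i))).
rewrite [leRHS]addeA -belowS.
apply: leeD2r.
rewrite -ge0_muleDr// lee_pmul2l//.
have -> : ~` below i.+1 =
    ~` below i `|` (below i `&` ~` [set w | V i.+1 w <= a%:E]).
  rewrite belowS setCI; apply/seteqP; split => w [wi|wi]; [by left| |by left|].
    by have [wb|wb] := pselect (below i w); [right|left].
  by right; case: wi.
by apply: measureU2 => //; exact: measurableC.
Qed.

(** [below_bound] bounds the probability of having crossed by time n by 1 / a, uniformly in n; these
    events increase, so continuity from below gives the same bound for ever crossing. *)
Lemma maximal_inequality :
  (1 - a^-1)%:E <= Pr [set w | forall i, V i w <= a%:E].
Proof.
have -> : [set w | forall i, V i w <= a%:E] = ~` \bigcup_i ~` below i.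
  rewrite setC_bigcup; under eq_bigcapr do rewrite setCK.
  by apply/seteqP; split => [w wi i _ l _|w wi i]; [exact: wi|exact: (wi i I i)].
have mB i : measurable (~` below i) by exact: measurableC.
have mUB : measurable (\bigcup_i ~` below i) by exact: bigcup_measurable.
rewrite probability_setC// EFinB leeB//.
have cvgB : Pr (~` below n) @[n --> \oo] --> Pr (\bigcup_i ~` below i).
  apply: nondecreasing_cvg_mu => // m n mn; apply/subsetPset; apply: subsetC.
  by move=> w wn l lm; apply: wn; exact: leq_trans mn.
rewrite -(cvg_lim _ cvgB)//; apply: lime_le; first by apply/cvg_ex; eexists; exact: cvgB.
apply: nearW => n.
rewrite -(@lee_pmul2l _ a%:E)// -EFinM divff ?gt_eqF//.
by apply: le_trans (below_bound n); rewrite leeDl// integral_ge0.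
Qed.

End maximal_inequality.

(** * The filtration generated by the samples *)

Section histories.
Context dW dT (W : measurableType dW) (T : measurableType dT).
Variable Z : nat -> W -> T.

Definition cylinder_set (A : nat -> set T) (i : nat) : set W :=
  \bigcap_(l in `I_i) Z l @^-1` A l.

(** Every coordinate below i is constrained, possibly by [setT], which makes this a pi-system
    containing the whole space. *)
Definition cylinders (i : nat) : set (set W) :=
  [set cylinder_set A i | A in [set A | forall l, measurable (A l)]].

Lemma cylindersI i : setI_closed (cylinders i).
Proof.
move=> _ _ [A mA <-] [B mB <-]; exists (fun l => A l `&` B l).
  by move=> l; exact: measurableI.
by rewrite /cylinder_set -bigcapI.
Qed.

Lemma cylindersT i : cylinders i setT.
Proof.
exists (fun=> setT); first by move=> l; exact: measurableT.
by rewrite /cylinder_set bigcapT.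
Qed.

(** Measurability on this type is adaptedness to the first i samples, and a kernel from it is a
    candidate conditional law of sample i. *)
Definition history (i : nat) : Type := g_sigma_algebraType (cylinders i).
HB.instance Definition _ i := Measurable.on (history i).

Lemma measurable_history_coord i l : (l < i)%N ->
  measurable_fun [set: history i] (Z l).
Proof.
move=> li _ B mB; rewrite setTI; apply: sub_sigma_algebra.
exists (fun m => if m == l then B else setT); first by move=> m; case: ifP.
apply/seteqP; split => [w /(_ l li)|w wB m _] /=; first by rewrite eqxx.
by case: eqVneq => [->|].
Qed.

Lemma measurable_to_history d (Y : measurableType d) i (g : Y -> W) :
  (forall l, (l < i)%N -> measurable_fun setT (fun y => Z l (g y))) ->
  measurable_fun setT (g : Y -> history i).
Proof.
move=> mg; apply: (@measurability _ _ Y (history i) setT _ (cylinders i)) => // _ [_ [A mA <-] <-].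
rewrite setTI /cylinder_set preimage_bigcap.
by apply: fin_bigcap_measurable => // l li; rewrite -[X in measurable X]setTI; exact: mg.
Qed.

End histories.

Section mixture_supermartingale.
Context dW dT dP (W : measurableType dW) (T : measurableType dT)
  (Theta : measurableType dP) (R : realType).
Variables (Pr : probability W R) (P : probability Theta R).
Variables (Z : nat -> W -> T) (mZ : forall i, measurable_fun setT (Z i)).
Variable kappa : forall i, R.-pker (history Z i) ~> T.
Local Open Scope ereal_scope.
Hypothesis sampling : forall i A B, cylinders Z i A -> measurable B ->
  Pr (A `&` Z i @^-1` B) = \int[Pr]_(w in A) kappa i w B.

Variables (M : nat -> Theta * W -> R) (y : nat -> Theta * W * T -> R).
Hypotheses (M_ge0 : forall i x, (0 <= M i x)%R) (y_ge0 : forall i x, (0 <= y i x)%R).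
Hypotheses (M0 : forall x, M 0 x = 1%R)
  (MS : forall i t w, M i.+1 (t, w) = (M i (t, w) * y i (t, w, Z i w))%R).
Hypotheses
  (mM : forall i, measurable_fun [set: Theta * history Z i] (M i))
  (my : forall i, measurable_fun [set: Theta * history Z i * T] (y i)).
Hypothesis y_mean : forall i t w, \int[kappa i w]_z (y i (t, w, z))%:E <= 1.

Let V i w : \bar R := \int[P]_t (M i (t, w))%:E.

Let mid i : measurable_fun setT (fun w : W => w : history Z i).
Proof. by apply: measurable_to_history => l _; exact: mZ. Qed.

Let mVh i : measurable_fun [set: history Z i] (V i).
Proof.
have mM' : measurable_fun [set: Theta * history Z i] (EFin \o M i).
  exact/measurable_EFinP.
apply: (@measurable_fun_fubini_tonelli_G _ _ _ _ _ P _ mM').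
by move=> x; rewrite lee_fin.
Qed.

Let mV i : measurable_fun setT (V i).
Proof. exact: (measurableT_comp (@mVh i) (@mid i)). Qed.

(** Given the past, the new sample enters only through the factor [y i], whose conditional mean is
    at most 1 for each fixed t; Tonelli carries this through the mixture over [P]. *)
Let V_supermartingale i (B : set W) : measurable (B : set (history Z i)) ->
  \int[Pr]_(w in B) V i.+1 w <= \int[Pr]_(w in B) V i w.
Proof.
move=> mB.
have mBW : measurable B.
  by have := @mid i measurableT _ mB; rewrite setTI.
(* The integrand over B at time i + 1, with the new sample freed as an independent argument so that
   disintegration applies. *)
pose g (x : history Z i * T) : \bar R :=
  (\1_B x.1)%:E * \int[P]_t (M i (t, x.1) * y i (t, x.1, x.2))%:E.
have int0 x : 0 <= \int[P]_t (M i (t, x.1) * y i (t, x.1, x.2))%:E.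
  by apply: integral_ge0 => t _; rewrite lee_fin mulr_ge0.
have g0 x : 0 <= g x by rewrite mule_ge0// lee_fin.
have mMy : measurable_fun [set: Theta * (history Z i * T)]
    (fun u => (M i (u.1, u.2.1) * y i (u.1, u.2.1, u.2.2))%:E).
  have m1 : measurable_fun [set: Theta * (history Z i * T)]
      (fun u => (u.1, u.2.1)).
    by apply: measurable_fun_pair => //; exact: measurableT_comp.
  apply/measurable_EFinP; apply: measurable_funM.
    exact: (measurableT_comp (@mM i) m1).
  have m2 : measurable_fun [set: Theta * (history Z i * T)]
      (fun u => (u.1, u.2.1, u.2.2)).
    by apply: measurable_fun_pair => //; exact: measurableT_comp.
  exact: (measurableT_comp (@my i) m2).
have mg : measurable_fun [set: history Z i * T] g.
  apply: emeasurable_funM.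
    apply/measurable_EFinP.
    exact: (measurableT_comp (measurable_indic (D := setT) mB) measurable_fst).
  apply: (@measurable_fun_fubini_tonelli_G _ _ _ _ _ P _ mMy).
  by move=> x; rewrite lee_fin mulr_ge0.
rewrite integral_mkcond [leRHS]integral_mkcond.
rewrite (_ : (fun w => _) = fun w : W => g (w, Z i w)); last first.
  apply/funext => w; rewrite epatch_indic /g muleC; congr (_ * _).
  by apply: eq_integral => t _; rewrite MS.
have := integral_disintegration (@mid i) (mZ i) erefl (@cylindersI _ _ _ _ Z i)
  (cylindersT Z i) (@sampling i) g0 mg.
move=> ->.
apply: ge0_le_integral => //.
- by move=> w _; apply: integral_ge0 => z _.
- have mk := measurable_fun_integral_finite_kernel g (kappa i) g0 mg.
  exact: (measurableT_comp mk (@mid i)).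
- by apply/measurable_restrict; rewrite ?setIT//; exact: measurable_funTS.
move=> w _; rewrite epatch_indic muleC /g /=.
rewrite ge0_integralZl//; last 2 first.
  - have : measurable_fun setT (fun x : history Z i * T =>
      \int[P]_t (M i (t, x.1) * y i (t, x.1, x.2))%:E).
      apply: (@measurable_fun_fubini_tonelli_G _ _ _ _ _ P _ mMy).
      by move=> x; rewrite lee_fin mulr_ge0.
    by move/measurable_fun_pair2 => /(_ w).
  - by move=> z _; exact: (int0 (w, z)).
rewrite lee_wpmul2l// ?lee_fin//.
have mw : measurable_fun [set: T * Theta] (fun u => (u.2, ((w : history Z i), u.1))).
  by apply: measurable_fun_pair => //; exact: measurable_fun_pair.
pose h u : \bar R := (M i (u.2, w) * y i (u.2, w, u.1))%:E.
have mh : measurable_fun [set: T * Theta] h by exact: (measurableT_comp mMy mw).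
have h0 u : 0 <= h u by rewrite lee_fin mulr_ge0.
(* After the exchange the sample is integrated first, with t fixed, and [M i (t, w)] comes out as a
   constant. *)
rewrite [leLHS](fubini_tonelli (m1 := kernel_probability (kappa i) w) (m2 := P) h)//.
apply: ge0_le_integral => //.
- by move=> t _; exact: integral_ge0.
- exact: measurable_fun_fubini_tonelli_G.
- apply/measurable_EFinP.
  exact: (@measurable_fun_pair1 _ _ _ _ (history Z i) _ _ w (@mM i)).
move=> t _; rewrite /h /=; under eq_integral do rewrite EFinM.
rewrite ge0_integralZl//.
- by rewrite -[leRHS]mule1 lee_wpmul2l ?lee_fin//; exact: y_mean.
- apply/measurable_EFinP.
  exact: (@measurable_fun_pair2 _ _ _ (Theta * history Z i)%type _ _ _ (t, w) (@my i)).
- by move=> z _; rewrite lee_fin.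
- by rewrite lee_fin.
Qed.

Lemma mixture_ville (a : R) : (0 < a)%R ->
  exists E, [/\ measurable E, (1 - a^-1)%:E <= Pr E &
    forall w, E w -> forall i, \int[P]_t (M i (t, w))%:E <= a%:E].
Proof.
move=> a0; exists [set w | forall i, V i w <= a%:E]; split => //.
  have -> : [set w | forall i, V i w <= a%:E] =
      \bigcap_i [set w | V i w <= a%:E].
    by apply/seteqP; split => [w wV i _|w wV i]; [exact: wV|exact: (wV i I)].
  apply: bigcap_measurable => // i _; rewrite -[X in measurable X]setTI.
  exact: emeasurable_fun_infty_c.
apply: maximal_inequality => //.
- by move=> i w; apply: integral_ge0 => t _; rewrite lee_fin.
- rewrite (_ : (fun w => _) = cst 1); last first.
    apply/funext => w; rewrite /V; under eq_integral do rewrite M0.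
    by rewrite integral_cst// mul1e; exact: probability_setT.
  by rewrite integral_cst// mul1e probability_le1.
move=> i; apply: V_supermartingale.
(* The no-crossing event belongs to the history at time i, because each [V l] with l <= i depends
   only on samples before l. *)
have -> : below V a i = \bigcap_(l in `I_i.+1) [set w | V l w <= a%:E].
  by apply/seteqP; split => w wi l; exact: wi.
apply: fin_bigcap_measurable => // l li; rewrite -[X in measurable X]setTI.
apply: emeasurable_fun_infty_c => //.
apply: (measurableT_comp (@mVh l)).
apply: measurable_to_history => m ml; apply: measurable_history_coord.
exact: leq_trans ml _.
Qed.

End mixture_supermartingale.

(** * The conditional law of one sample *)

Section ordinal_integral.
Context (K : nat) (R : realType).
Local Open Scope ereal_scope.

Lemma integral_ordinal (mu : {measure set 'I_K.+1 -> \bar R})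
    (f : 'I_K.+1 -> \bar R) : (forall a, 0 <= f a) ->
  \int[mu]_a f a = \sum_a f a * mu [set a].
Proof.
move=> f0.
transitivity (\int[mu]_b \sum_a f a * (\1_[set a] b)%:E).
  apply: eq_integral => b _; rewrite (bigD1 b)//= indicE mem_set// mule1.
  rewrite big1 ?adde0// => a ab; rewrite indicE memNset ?mule0//=.
  by apply/nesym/eqP.
rewrite ge0_integral_sum//; last by move=> a b _; rewrite mule_ge0// lee_fin.
apply: eq_bigr => a _; rewrite ge0_integralZl//.
  by rewrite integral_indic// setIT.
Qed.

End ordinal_integral.

Lemma measurable_ordinal_pairP (K : nat) d d' (Y : measurableType d)
    (T : measurableType d') (g : Y * 'I_K.+1 -> T) :
  (forall a, measurable_fun setT (fun y => g (y, a))) -> measurable_fun setT g.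
Proof.
move=> mg _ B mB; rewrite setTI.
have -> : g @^-1` B =
    \bigcup_(a in [set: 'I_K.+1]) ((fun y => g (y, a)) @^-1` B `*` [set a]).
  by apply/seteqP; split => [[y a] gB|[y a] [b _ [/= gB ->]]//]; exists a.
apply: fin_bigcup_measurable => // a _; apply: measurableX => //.
by rewrite -[X in measurable X]setTI; exact: mg.
Qed.

Section triple_kernel.
Context {R : realType} {dX dG} {X : measurableType dX} {G : measurableType dG}.
Context {K : nat}.
Variables (nu : probability X R) (p : R.-pker (X * 'I_K.+1) ~> R)
  (alpha : R.-pker (G * X) ~> 'I_K.+1).
Local Open Scope ereal_scope.

Let mXa : measurable_fun setT (fun u : G * X * 'I_K.+1 => (u.1.2, u.2)).
Proof.
apply: measurable_fun_pair => //.
exact: (measurableT_comp measurable_snd measurable_fst).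
Qed.

Let mXac : measurable_fun setT
  (fun u : G * X * 'I_K.+1 * R => (u.1.1.2, u.1.2, u.2)).
Proof.
apply: measurable_fun_pair => //.
exact: (measurableT_comp mXa measurable_fst).
Qed.

Let contexts : R.-pker G ~> X :=
  kprobability (measurable_cst (nu : pprobability X R)).
Let cost_kernel : R.-sfker (G * X * 'I_K.+1)%type ~> (X * 'I_K.+1 * R)%type :=
  (kpreimage p mXa \; kdirac mXac).
Let action_kernel : R.-sfker (G * X)%type ~> (X * 'I_K.+1 * R)%type :=
  (alpha \; cost_kernel).
Let joint_kernel : R.-sfker G ~> (X * 'I_K.+1 * R)%type :=
  (contexts \; action_kernel).

Let integral_joint g (h : X * 'I_K.+1 * R -> \bar R) :
  (forall z, 0 <= h z) -> measurable_fun setT h ->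
  \int[joint_kernel g]_z h z = \int[nu]_x \sum_a
    (fine (alpha (g, x) [set a]))%:E * \int[p (x, a)]_c h (x, a, c).
Proof.
move=> h0 mh; rewrite integral_kcomp//; apply: eq_integral => x _.
rewrite integral_kcomp// integral_ordinal; last by move=> a; exact: integral_ge0.
apply: eq_bigr => a _; rewrite muleC fineK ?fin_num_kernel//; congr (_ * _).
rewrite integral_kcomp//; apply: eq_integral => c _.
by rewrite integral_dirac// diracT mul1e.
Qed.

(** This is [triple_law] for a policy that also depends on a point of G (see [triple_kernelE]);
    composing kernels yields its measurability in that point. *)
Definition triple_kernel : G -> {measure set (X * 'I_K.+1 * R) -> \bar R} :=
  joint_kernel.

HB.instance Definition _ := isKernel.Build _ _ _ _ _ triple_kernel
  (measurable_kernel joint_kernel).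

Lemma sum_kernel_ordinal g x :
  \sum_a (fine (alpha (g, x) [set a]))%:E = 1.
Proof.
rewrite -[RHS](prob_kernel (s := alpha) (g, x)) -[RHS]mul1e -integral_cst//.
rewrite integral_ordinal//; apply: eq_bigr => a _.
by rewrite mul1e fineK ?fin_num_kernel.
Qed.

Let triple_kernel_prob g : triple_kernel g setT = 1.
Proof.
rewrite -[LHS]mul1e -integral_cst// integral_joint//.
rewrite -[RHS](probability_setT nu) -[RHS]mul1e -integral_cst//.
apply: eq_integral => x _.
rewrite /= -[RHS](sum_kernel_ordinal g x); apply: eq_bigr => a _.
by rewrite integral_cst// mul1e prob_kernel mule1.
Qed.

HB.instance Definition _ := Kernel_isProbability.Build _ _ _ _ _
  triple_kernel triple_kernel_prob.

Lemma integral_triple_kernel g (h : X * 'I_K.+1 * R -> \bar R) :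
  (forall z, 0 <= h z) -> measurable_fun setT h ->
  \int[triple_kernel g]_z h z = \int[nu]_x \sum_a
    (fine (alpha (g, x) [set a]))%:E * \int[p (x, a)]_c h (x, a, c).
Proof. exact: integral_joint. Qed.

Lemma triple_kernelE g B : measurable B ->
  triple_kernel g B =
  triple_law nu p (fun x a => fine (alpha (g, x) [set a])) B.
Proof.
move=> mB.
have := @integral_indic _ _ _ (triple_kernel g) setT measurableT B mB.
rewrite setIT => <-; rewrite integral_triple_kernel; last 2 first.
- by move=> z; rewrite lee_fin.
- exact/measurable_EFinP/measurable_indic.
apply: eq_integral => x _; apply: eq_bigr => a _; congr (_ * _).
rewrite -[RHS]/(p (x, a) ((fun c => (x, a, c)) @^-1` B)).
rewrite -[in RHS](setIT (_ @^-1` _)) -integral_indic//.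
rewrite -[X in measurable X]setTI.
exact: (measurable_pair1 (x, a)).
Qed.

End triple_kernel.

(** * Exponential moment of one log-weight *)

Lemma integrable_bounded d (T : measurableType d) (R : realType)
    (P : probability T R) (f : T -> R) (M : R) :
  measurable_fun setT f -> (forall x, `|f x| <= M) ->
  P.-integrable setT (EFin \o f).
Proof.
move=> mf fM; apply: (le_integrable measurableT _ _
  (finite_measure_integrable_cst P M measurableT)).
- exact/measurable_EFinP.
- by move=> x _; rewrite lee_fin (le_trans (fM x))// ler_norm.
Qed.

(* The logarithm of one factor of the supermartingale, for a behaviour
   probability q, a predictor indicator u and a cost c. *)
Definition log_weight (R : realType) (lambda q u c : R) : R :=
  u * ln (1 - lambda * c / (q * (1 + lambda * c))) - ln (1 + lambda * c)^-1.

(** The quotient inside [ln] is nonpositive, so its argument is at least 1 and the exponential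
    undoes it. Writing the result with |c| prepares for integrals of nonnegative functions. *)
Lemma expR_log_weight (R : realType) (lambda q c : R) (b : bool) :
  0 < lambda < 1 -> 0 <= q -> -1 <= c <= 0 ->
  expR (log_weight lambda q b%:R c) =
  1 + (lambda * b%:R / q - lambda) * `|c|.
Proof.
move=> /andP[l0 l1] q0 /andP[c1 c0].
have lc : 0 < 1 + lambda * c by nra.
rewrite /log_weight expRB lnK ?posrE ?invr_gt0// invrK ler0_norm//.
case: b; rewrite /= ?mulr1n ?mulr0n; last by rewrite mul0r expR0 mul1r; ring.
have neg : lambda * c / (q * (1 + lambda * c)) <= 0.
  by rewrite mulr_le0_ge0 ?invr_ge0 ?mulr_ge0 ?mulr_ge0_le0// ltW.
rewrite mul1r lnK; last by rewrite posrE; lra.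
(* For q = 0 both quotients are 0 by convention and both sides equal 1 + lambda c. *)
have [->|q0'] := eqVneq q 0; first by rewrite mul0r invr0; ring.
by field; rewrite q0' gt_eqF.
Qed.

Lemma measurable_log_weight d (T : measurableType d) (R : realType)
    (lambda : R) (q u c : T -> R) :
  measurable_fun setT q -> measurable_fun setT u -> measurable_fun setT c ->
  measurable_fun setT (fun x => log_weight lambda (q x) (u x) (c x)).
Proof.
move=> mq mu mc.
have mlc : measurable_fun setT (fun x => 1 + lambda * c x).
  by apply: measurable_funD => //; exact: measurable_funM.
apply: measurable_funB; last first.
  by apply: measurableT_comp => //; exact: measurable_fun_inv.
apply: measurable_funM => //; apply: measurableT_comp => //.
apply: measurable_funB => //; apply: measurable_funM.
  exact: measurable_funM.
by apply: measurable_fun_inv; exact: measurable_funM.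
Qed.

Section costs.
Context {R : realType} {dX} {X : measurableType dX} {K : nat}.
Variables (nu : probability X R) (p : R.-pker (X * 'I_K.+1) ~> R).
Hypothesis p_cost : forall xa, p xa [set c | -1 <= c <= 0] = 1%E.
Local Notation action := 'I_K.+1.

Lemma ae_cost xa : {ae p xa, forall c, -1 <= c <= 0}.
Proof.
have mA : measurable [set c : R | -1 <= c <= 0].
  rewrite (_ : [set c | _] = [set` `[-1, 0]%R]); first exact: measurable_itv.
  by apply/seteqP; split => c; rewrite /= in_itv.
exists (~` [set c | -1 <= c <= 0]); split=> //; first exact: measurableC.
rewrite -[LHS]/(kernel_probability p xa _) probability_setC//.
by rewrite [X in (1 - X)%E](p_cost xa) subee.
Qed.

(** Minus the mean cost (see [mean_costE]); nonnegativity makes Tonelli available throughout. *)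
Definition loss (xa : X * action) : R := fine (\int[p xa]_c `|c|%:E)%E.

Let abs_cost_le1 xa : (\int[p xa]_c `|c|%:E <= 1)%E.
Proof.
rewrite -[leRHS](prob_kernel (s := p) xa) -[leRHS]mul1e -integral_cst//.
apply: ae_ge0_le_integral => //.
- by apply/measurable_EFinP; apply: normr_measurable.
apply: filterS (ae_cost xa) => c /andP[c1 c0] _ /=.
by rewrite lee_fin ler0_norm//; lra.
Qed.

Let abs_cost_fin xa : (\int[p xa]_c `|c|%:E \is a fin_num)%E.
Proof.
rewrite ge0_fin_numE; first by rewrite (le_lt_trans (abs_cost_le1 xa)) ?ltry.
by apply: integral_ge0 => c _; rewrite lee_fin.
Qed.

Lemma lossE xa : (loss xa)%:E = (\int[p xa]_c `|c|%:E)%E.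
Proof. by rewrite fineK. Qed.

Lemma loss_ge0 xa : 0 <= loss xa.
Proof. by apply: fine_ge0; apply: integral_ge0 => c _; rewrite lee_fin. Qed.

Lemma loss_le1 xa : loss xa <= 1.
Proof. by rewrite -lee_fin lossE. Qed.

Lemma measurable_loss : measurable_fun setT loss.
Proof.
apply: measurableT_comp => //.
apply: (measurable_fun_integral_kernel (l := p)).
- by move=> U mU; exact: measurable_kernel.
- by move=> c; rewrite lee_fin.
- by apply/measurable_EFinP; apply: normr_measurable.
Qed.

Lemma mean_costE a x : mean_cost p a x = - loss (x, a).
Proof.
rewrite /mean_cost /Rintegral /loss -fineN; congr fine.
rewrite -integral_ge0N; last by move=> c _; rewrite lee_fin.
apply: ae_eq_integral => //.
- apply/measurable_EFinP; 
  exact: (measurableT_comp (@oppr_measurable R setT) (@normr_measurable R setT)).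
- apply: filterS (ae_cost (x, a)) => c /andP[_ c0] _.
  by rewrite ler0_norm// -EFinN opprK.
Qed.

Definition policy_loss (q : @policy R dX X K) (x : X) : R :=
  \sum_a q x a * loss (x, a).

(** [policy] is a bare function type; these properties are shared by behaviour policies, predictors
    and their mixtures. *)
Definition is_policy (q : @policy R dX X K) : Prop :=
  [/\ forall a, measurable_fun setT (q ^~ a), forall x a, 0 <= q x a
    & forall x, \sum_a q x a = 1].

Lemma policy_loss_ge0 q x : is_policy q -> 0 <= policy_loss q x.
Proof.
by move=> [_ q0 _]; apply: sumr_ge0 => a _; rewrite mulr_ge0// loss_ge0.
Qed.

Lemma policy_loss_le1 q x : is_policy q -> policy_loss q x <= 1.
Proof.
move=> [_ q0 q1]; rewrite -(q1 x); apply: ler_sum => a _.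
by rewrite ler_piMr// loss_le1.
Qed.

Lemma measurable_policy_loss q : is_policy q -> measurable_fun setT (policy_loss q).
Proof.
move=> [mq _ _]; apply: measurable_sum => a; apply: measurable_funM => //.
exact: (measurable_fun_pair1 a measurable_loss).
Qed.

Lemma integrable_policy_loss q : is_policy q ->
  nu.-integrable setT (EFin \o policy_loss q).
Proof.
move=> Hq; apply: (@integrable_bounded _ _ _ _ _ 1).
  exact: measurable_policy_loss.
by move=> x; rewrite ger0_norm ?policy_loss_ge0 ?policy_loss_le1.
Qed.

Lemma riskE q : is_policy q ->
  (risk nu p q)%:E = (- \int[nu]_x (policy_loss q x)%:E)%E.
Proof.
move=> Hq; rewrite /risk /Rintegral.
have -> : (\int[nu]_x (\sum_a q x a * mean_cost p a x)%:E =
    - \int[nu]_x (policy_loss q x)%:E)%E.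
  rewrite -integral_ge0N; last by move=> x _; rewrite lee_fin policy_loss_ge0.
  apply: eq_integral => x _; rewrite -EFinN -sumrN; congr EFin.
  by apply: eq_bigr => a _; rewrite mean_costE mulrN.
rewrite fineK// fin_numN; apply: integrable_fin_num => //.
exact: integrable_policy_loss.
Qed.

Lemma integral_expR_log_weight (lambda q : R) (b : bool) xa :
  0 < lambda < 1 -> 0 <= q ->
  (\int[p xa]_c (expR (log_weight lambda q b%:R c))%:E)%E =
  (1 + (lambda * b%:R / q - lambda) * loss xa)%:E.
Proof.
move=> lambda01 q0; set k := _ - lambda.
have iabs : (p xa).-integrable setT (fun c => `|c|%:E).
  apply/integrableP; split; first by apply/measurable_EFinP; apply: normr_measurable.
  under eq_integral do rewrite /= normr_id.
  by rewrite (le_lt_trans (abs_cost_le1 xa)) ?ltry.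
transitivity (\int[p xa]_c (cst 1 c + k%:E * `|c|%:E))%E.
  apply: ae_eq_integral => //.
  - apply/measurable_EFinP; apply: measurableT_comp => //.
    exact: measurable_log_weight.
  - apply: emeasurable_funD => //; apply: measurable_funeM.
    by apply/measurable_EFinP; apply: normr_measurable.
  - apply: filterS (ae_cost xa) => c c01 _.
    by rewrite expR_log_weight.
rewrite integralD//=; last 2 first.
- apply: (@finite_measure_integrable_cst _ _ _ (kernel_probability p xa) setT 1).
  exact: measurableT.
- exact: integrableZl.
rewrite integralZl// integral_cst// mul1e prob_kernel.
by rewrite -lossE.
Qed.

Definition indicator_policy (phi : X -> action) : @policy R dX X K :=
  fun x a => (phi x == a)%:R.

Lemma indicator_policyP phi :
  measurable_fun setT phi -> is_policy (indicator_policy phi).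
Proof.
move=> mphi; split=> [a|x a|x]; rewrite /indicator_policy.
- have m : measurable_fun [set: action] (fun b => (b == a)%:R : R) by [].
  exact: (measurableT_comp m mphi).
- by [].
- rewrite (bigD1 (phi x))//= eqxx big1 ?addr0// => a ax.
  by rewrite eq_sym (negbTE ax).
Qed.

(* Importance weighting is exact where q > 0; where q = 0 (and r / q = 0) it
   only drops a nonnegative loss. *)
Lemma integral_expR_excess (lambda : R) (q : @policy R dX X K) (phi : X -> action) :
  0 < lambda < 1 -> is_policy q -> measurable_fun setT phi ->
  (\int[nu]_x \sum_a (q x a)%:E * \int[p (x, a)]_c
     (expR (lambda * (risk nu p (indicator_policy phi) - risk nu p q) +
        log_weight lambda (q x a) (indicator_policy phi x a) c))%:E <= 1)%E.
Proof.
move=> l01 Hq /indicator_policyP Hu; have /andP[l0 l1] := l01.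
have [mq q0 q1] := Hq; set u := indicator_policy phi in Hu *.
set D := _ - _.
have inner x : (\sum_a (q x a)%:E * \int[p (x, a)]_c
    (expR (lambda * D + log_weight lambda (q x a) (u x a) c))%:E <=
    (expR (lambda * D))%:E *
      (cst 1 x + (lambda%:E * (policy_loss u x)%:E
                - lambda%:E * (policy_loss q x)%:E)))%E.
  under eq_bigr => a _.
    under eq_integral do rewrite expRD EFinM.
    rewrite ge0_integralZl//; last first.
      apply/measurable_EFinP; apply: measurableT_comp => //.
      exact: measurable_log_weight.
    rewrite integral_expR_log_weight// -!EFinM; over.
  rewrite sumEFin [leRHS](_ : _ = (expR (lambda * D) *
    (1 + (lambda * policy_loss u x - lambda * policy_loss q x)))%:E)// lee_fin.
  rewrite /policy_loss !mulr_sumr -sumrB -[X in _ * (X + _)](q1 x) -big_split/= mulr_sumr.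
  apply: ler_sum => a _; rewrite mulrCA ler_pM2l ?expR_gt0//.
  have := loss_ge0 (x, a); rewrite /u/indicator_policy; case: eqP => _ L0; last first.
    rewrite /= ?mulr0n !(mulr0, mul0r); nra.
  have [->|qx] := eqVneq (q x a) 0.
    by rewrite !mul0r mulr0 subr0 add0r mulr1n mul1r mulr_ge0// ltW.
  suff -> : q x a * (1 + (lambda * true%:R / q x a - lambda) * loss (x, a)) =
      q x a + (lambda * (true%:R * loss (x, a)) - lambda * (q x a * loss (x, a))).
    by [].
  by rewrite /= mulr1n; field.
apply: (@le_trans _ _ (\int[nu]_x ((expR (lambda * D))%:E *
      (cst 1 x + (lambda%:E * (policy_loss u x)%:E
                - lambda%:E * (policy_loss q x)%:E))))%E).
  apply: ge0_le_integral => //.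
  - move=> x _; apply: sume_ge0 => a _; rewrite mule_ge0 ?lee_fin//.
    by apply: integral_ge0 => c _; rewrite lee_fin expR_ge0.
  - apply: emeasurable_sum => a; apply: emeasurable_funM; first exact/measurable_EFinP.
    have mq2 : measurable_fun setT (fun v : X * action => q v.1 v.2).
      by apply: measurable_ordinal_pairP => b; exact: mq.
    have mu2 : measurable_fun setT (fun v : X * action => u v.1 v.2).
      by apply: measurable_ordinal_pairP => b; have [mu _ _] := Hu; exact: mu.
    pose k (v : X * action * R) := (expR (lambda * D +
      log_weight lambda (q v.1.1 v.1.2) (u v.1.1 v.1.2) v.2))%:E.
    have mk : measurable_fun setT k.
      apply/measurable_EFinP; apply: measurableT_comp => //.
      apply: measurable_funD => //; apply: measurable_log_weight.
      + exact: (measurableT_comp mq2 measurable_fst).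
      + exact: (measurableT_comp mu2 measurable_fst).
      + exact: measurable_snd.
    have k0 v : (0 <= k v)%E by rewrite lee_fin expR_ge0.
    have := measurable_fun_integral_finite_kernel k p k0 mk.
    exact: measurable_fun_pair1.
  - apply: measurable_funeM; apply: emeasurable_funD => //.
    by apply: emeasurable_funB; apply: measurable_funeM; apply/measurable_EFinP;
      exact: measurable_policy_loss.
have i1 : nu.-integrable setT (cst 1%E) by exact: finite_measure_integrable_cst.
have iu : nu.-integrable setT (fun x => lambda%:E * (policy_loss u x)%:E)%E.
  by apply: integrableZl => //; exact: integrable_policy_loss.
have iq : nu.-integrable setT (fun x => lambda%:E * (policy_loss q x)%:E)%E.
  by apply: integrableZl => //; exact: integrable_policy_loss.
rewrite integralZl//; last exact: (integrableD _ i1 (integrableB _ iu iq)).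
rewrite integralD//; last exact: (integrableB _ iu iq).
rewrite integralB// !integralZl//; [|exact: integrable_policy_loss..].
have EI r : is_policy r -> (\int[nu]_x (policy_loss r x)%:E = (- risk nu p r)%:E)%E.
  by move=> Hr; rewrite EFinN riskE// oppeK.
have -> : (\int[nu]_x cst 1 x = 1)%E.
  by rewrite integral_cst// mul1e; exact: probability_setT.
rewrite !EI// [leLHS](_ : _ = (expR (lambda * D) *
  (1 + (lambda * (- risk nu p u) - lambda * (- risk nu p q))))%:E)// lee_fin.
(* It remains to see that 1 - lambda D <= exp (- lambda D). *)
rewrite -ler_pdivlMl ?expR_gt0// mulr1 -expRN.
suff -> : 1 + (lambda * - risk nu p u - lambda * - risk nu p q) =
    1 + - (lambda * D) by exact: expR_ge1Dx.
by rewrite /D; ring.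
Qed.

End costs.

(** * Conditional independence inside a batch *)

Section batches.
Variable n : nat -> nat.

Lemma batch_startS k : batch_start n k.+1 = (batch_start n k + n k)%N.
Proof. by rewrite /batch_start big_ord_recr. Qed.

Lemma leq_batch_start : {homo batch_start n : j k / (j <= k)%N}.
Proof.
apply: homo_leq => [//|? ? ?|k]; first exact: leq_trans.
by rewrite batch_startS leq_addr.
Qed.

Lemma batch_index_unique i j k :
  (batch_start n j <= i < batch_start n j.+1)%N ->
  (batch_start n k <= i < batch_start n k.+1)%N -> j = k.
Proof.
move=> /andP[j1 j2] /andP[k1 k2]; apply/eqP; rewrite eqn_leq.
apply/andP; split; rewrite leqNgt; apply/negP => /leq_batch_start h.
  by move: (leq_ltn_trans (leq_trans h j1) k2); rewrite ltnn.
by move: (leq_ltn_trans (leq_trans h k1) j2); rewrite ltnn.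
Qed.

Hypothesis n_gt0 : forall k, (0 < n k)%N.

(** When the next index leaves batch k it is the first index of batch k + 1, which is nonempty. *)
Lemma batch_index i :
  exists k, (batch_start n k <= i < batch_start n k.+1)%N.
Proof.
elim: i => [|i [k /andP[k1 k2]]].
  by exists 0%N; rewrite batch_startS /batch_start big_ord0 add0n n_gt0.
have [lt|ge] := ltnP i.+1 (batch_start n k.+1).
  by exists k; rewrite lt (leq_trans k1).
exists k.+1; rewrite ge/= (batch_startS k.+1) (leq_ltn_trans k2)//.
by rewrite -[ltnLHS]addn0 ltn_add2l.
Qed.

End batches.

Section sampling.
Context {R : realType} {dX} {X : measurableType dX} {K : nat}.
Variables (nu : probability X R) (p : R.-pker (X * 'I_K.+1) ~> R).
Context {dO} {Omega : measurableType dO}.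
Variables (Pr : probability Omega R) (pi0 : R.-pker X ~> 'I_K.+1)
  (n : nat -> nat) (Alg : sequential_algorithm R X K n)
  (Z : nat -> Omega -> X * 'I_K.+1 * R).
Hypothesis mZ : forall i, measurable_fun setT (Z i).

Local Notation pi_ := (behavior_policy Z pi0 Alg).

Lemma measurable_past_data i k : (batch_start n k <= i)%N ->
  measurable_fun [set: history Z i] (past_data n Z k).
Proof.
move=> ki; apply/measurable_fun_tnthP => l.
rewrite (_ : _ \o _ = Z l); last by apply/funext => w; rewrite /= tnth_mktuple.
apply: measurable_history_coord; exact: leq_trans (ltn_ord l) ki.
Qed.

(** The policy of batch k is a function of the samples before that batch, all of which lie in the
    history of sample i. *)
Lemma behavior_kernel i k : (batch_start n k <= i)%N ->
  exists alpha : R.-pker (history Z i * X) ~> 'I_K.+1,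
    forall w x a, pi_ k w x a = fine (alpha (w, x) [set a]).
Proof.
case: k => [_|k ki].
  by exists (kpreimage pi0 (@measurable_snd _ _ (history Z i) X)).
have m : measurable_fun [set: history Z i * X]
    (fun u => (past_data n Z k.+1 u.1, u.2)).
  apply: measurable_fun_pair => //.
  exact: (measurableT_comp (measurable_past_data ki) measurable_fst).
by exists (kpreimage (Alg k) m).
Qed.

Lemma is_policy_behavior k w : is_policy (pi_ k w).
Proof.
have [alpha alphaE] := behavior_kernel (leqnn (batch_start n k)).
split=> [a|x a|x].
- rewrite (_ : pi_ k w ^~ a = fun x => fine (alpha (w, x) [set a])); last first.
    by apply/funext => x; exact: alphaE.
  apply: measurableT_comp => //.
  have m := measurable_kernel alpha [set a] (I : measurable [set a]).
  exact: (@measurable_fun_pair2 _ _ _ (history Z _) _ _ _ w m).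
- by rewrite alphaE fine_ge0.
- apply: EFin_inj; rewrite -sumEFin -(sum_kernel_ordinal alpha w x).
  by apply: eq_bigr => a _; rewrite alphaE.
Qed.

Variables (b : nat -> nat)
  (alpha : forall i, R.-pker (history Z i * X) ~> 'I_K.+1).
Hypotheses
  (bP : forall i, (batch_start n (b i) <= i < batch_start n (b i).+1)%N)
  (alphaP : forall i w x a, pi_ (b i) w x a = fine (alpha i (w, x) [set a])).

Local Notation kappa i := (triple_kernel nu p (alpha i)).

Lemma triple_kernel_behavior i w B : measurable B ->
  kappa i w B = triple_law nu p (pi_ (b i) w) B.
Proof.
move=> mB; rewrite triple_kernelE//; congr triple_law.
by apply/funext => x; apply/funext => a; rewrite alphaP.
Qed.

Lemma cylinder_past k A : (forall l, measurable (A l)) ->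
  past_sigma_algebra n Z k (cylinder_set Z A (batch_start n k)).
Proof.
move=> mA; exists (\bigcap_(l in [set: 'I_(batch_start n k)])
    (fun t => tnth t l) @^-1` A l).
  apply: fin_bigcap_measurable => // l _.
  by rewrite -[X in measurable X]setTI; exact: measurable_tnth.
rewrite setTI; apply/seteqP; split => w wA.
  by move=> l lk; have := wA (Ordinal lk) I; rewrite /= tnth_mktuple.
by move=> l _; rewrite /= tnth_mktuple; exact: (wA l (ltn_ord l)).
Qed.

Hypothesis sampling : sequential_sampling n Z Pr nu p pi_.

Lemma cylinder_setS A i :
  cylinder_set Z A i.+1 = cylinder_set Z A i `&` Z i @^-1` A i.
Proof.
apply/seteqP; split => [w wA|w [wA wi] l].
  by split; [move=> l /= li|]; apply: wA => //=; exact: ltnW.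
by rewrite /= ltnS leq_eqVlt => /predU1P[->//|]; exact: wA.
Qed.

(** The hypothesis conditions on the past of the batch, but here A may also involve earlier samples
    of the same batch. By strong induction the earlier samples already have their conditional laws,
    which allows each event on such a sample to be traded for its conditional probability, back to
    the start of the batch, where the hypothesis applies. *)
Lemma sampling_rect i A B : cylinders Z i A -> measurable B ->
  Pr (A `&` Z i @^-1` B) = (\int[Pr]_(w in A) kappa i w B)%E.
Proof.
elim/ltn_ind: i A B => i IH _ B [A mA <-] mB.
set k := b i; set s := batch_start n k; set e := batch_start n k.+1.
have /andP[si ie] := bP i.
have bk j : (s <= j <= i)%N -> b j = k.
  move=> /andP[sj ji]; apply: (@batch_index_unique n j); first exact: bP.
  by rewrite sj (leq_ltn_trans ji).
(* The policy is frozen during a batch, so the same conditional law serves every index of the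
   batch. *)
pose tau w (D : set (X * 'I_K.+1 * R)) := fine (triple_law nu p (pi_ k w) D).
have tauE j w D : (s <= j <= i)%N -> measurable D ->
    (tau w D)%:E = kappa j w D.
  move=> /bk bj mD; rewrite /tau -bj -triple_kernel_behavior// fineK//.
  exact: fin_num_kernel.
have tau0 j w D : (s <= j <= i)%N -> measurable D -> 0 <= tau w D.
  by move=> sji mD; rewrite -lee_fin (tauE j).
(* Conditional probability, given the samples before j, of the events still to come up to and
   including sample i. *)
pose Phi j w := (\prod_(j <= l < i) tau w (A l)) * tau w B.
have sii : (s <= i <= i)%N by rewrite si leqnn.
have Phi0 j w : 0 <= Phi j w.
  by rewrite mulr_ge0 ?(tau0 i)// prodr_ge0// => l _; rewrite (tau0 i).
(* The event on sample j is replaced by its conditional probability, using the induction hypothesis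
   at j; [Phi j.+1] may be held fixed since it is measurable on the history of j. *)
have step j : (s <= j < i)%N ->
    (\int[Pr]_(w in cylinder_set Z A j.+1) (Phi j.+1 w)%:E =
     \int[Pr]_(w in cylinder_set Z A j) (Phi j w)%:E)%E.
  move=> /andP[sj ji].
  have sji : (s <= j <= i)%N by rewrite sj ltnW.
  have mC : measurable (cylinder_set Z A j : set (history Z j)).
    by apply: sub_sigma_algebra; exists A.
  have mtau D : measurable D -> measurable_fun [set: history Z j] (tau ^~ D).
    move=> mD; apply/measurable_EFinP.
    rewrite (_ : EFin \o _ = (kappa j) ^~ D); last first.
      by apply/funext => w; rewrite /= (tauE j).
    exact: measurable_kernel.
  have mPhi : measurable_fun [set: history Z j] (Phi j.+1).
    apply: measurable_funM; last exact: mtau.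
    apply: measurable_prod => l _; exact: mtau.
  pose g (x : history Z j * (X * 'I_K.+1 * R)) : \bar R :=
    ((\1_(cylinder_set Z A j) x.1 * Phi j.+1 x.1) * \1_(A j) x.2)%:E.
  have g0 x : (0 <= g x)%E.
    by rewrite lee_fin; apply: mulr_ge0 => //; apply: mulr_ge0.
  have mg : measurable_fun [set: history Z j * (X * 'I_K.+1 * R)] g.
    apply/measurable_EFinP; apply: measurable_funM.
      have m1 := measurable_funM (measurable_indic (D := setT) mC) mPhi.
      exact: (measurableT_comp m1 measurable_fst).
    exact: (measurableT_comp (measurable_indic (D := setT) (mA j)) measurable_snd).
  have mid : measurable_fun setT (fun w : Omega => w : history Z j).
    by apply: measurable_to_history => l _; exact: mZ.
  have E := integral_disintegration mid (mZ j) erefl (@cylindersI _ _ _ _ Z j)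
    (cylindersT Z j) (IH j ji) g0 mg.
  rewrite integral_mkcond [RHS]integral_mkcond.
  transitivity (\int[Pr]_w g (w, Z j w))%E.
    apply: eq_integral => w _; rewrite epatch_indic cylinder_setS /g /=.
    rewrite indicI /= -EFinM; congr EFin; ring.
  rewrite E; apply: eq_integral => w _; rewrite epatch_indic /g /=.
  under eq_integral do rewrite EFinM.
  rewrite ge0_integralZl//; last 2 first.
  - exact/measurable_EFinP/measurable_indic.
  - by rewrite lee_fin; apply: mulr_ge0.
  rewrite integral_indic// setIT -tauE// -!EFinM; congr EFin.
  rewrite /Phi (big_ltn ji); ring.
have chain j : (s <= j <= i)%N ->
    (\int[Pr]_(w in cylinder_set Z A j) (Phi j w)%:E =
     \int[Pr]_(w in cylinder_set Z A s) (Phi s w)%:E)%E.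
  elim: j => [|j IHj]; first by rewrite leqn0 => /andP[/eqP ->].
  move=> /andP[]; rewrite leq_eqVlt => /predU1P[-> //|].
  rewrite ltnS => sj ji; rewrite step ?sj// IHj// sj; exact: ltnW.
transitivity (\int[Pr]_(w in cylinder_set Z A i) (Phi i w)%:E)%E; last first.
  by apply: eq_integral => w _; rewrite /Phi big_geq// mul1r (tauE i).
rewrite chain//.
(* The batch identity needs one event per sample: A before i, B at i, and no constraint after i. *)
pose A' l := if (l < i)%N then A l else if l == i then B else setT.
have mA' l : measurable (A' l) by rewrite /A'; case: ifP => // _; case: ifP.
transitivity (\int[Pr]_(w in cylinder_set Z A s)
    (\prod_(s <= l < e) tau w (A' l))%:E)%E; last first.
  apply: eq_integral => w _; congr EFin.
  rewrite (@big_cat_nat _ _ _ i)//=; last exact: ltnW.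
  congr (_ * _).
    by apply: eq_big_nat => l /andP[_ li]; rewrite /A' li.
  (* The unconstrained samples after i contribute factors equal to 1. *)
  rewrite big_ltn// /A' ltnn eqxx big_nat big1 ?mulr1// => l /andP[il _].
  rewrite ltnNge (ltnW il)/= gtn_eqF//; apply: EFin_inj.
  by rewrite (tauE i)// prob_kernel.
rewrite -(sampling (cylinder_past k mA) mA'); congr (Pr _).
apply/seteqP; split => w [wA wB]; split.
- by move=> l /= ls; apply: wA => /=; exact: leq_trans ls si.
- move=> l /= /andP[sl le]; rewrite /A'; case: ifPn => [li|_]; first exact: wA.
  by case: eqP => // ->.
- move=> l /= li; have [ls|sl] := ltnP l s; first exact: wA.
  by have := wB l; rewrite /= sl /A' li; apply; exact: leq_trans li (ltnW ie).
- by have := wB i; rewrite /= si ie /A' ltnn eqxx; apply.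
Qed.

End sampling.

(** The supermartingale runs through samples in consecutive order, while the estimators are double
    sums over batches. *)
Lemma sum_batches (R : nmodType) (n b : nat -> nat) (F : nat -> nat -> R) m :
  (forall i, (batch_start n (b i) <= i < batch_start n (b i).+1)%N) ->
  \sum_(l < batch_start n m) F (b l) l =
  \sum_(j < m) \sum_(batch_start n j <= i < batch_start n j.+1) F j i.
Proof.
move=> bP; rewrite -(big_mkord xpredT (fun l => F (b l) l)).
elim: m => [|m IH]; first by rewrite /batch_start !big_ord0 big_geq.
rewrite big_ord_recr/= -IH (@big_cat_nat _ _ _ (batch_start n m))//=.
  by congr (_ + _); apply: eq_big_nat => l lm; rewrite (batch_index_unique (bP l) lm).
exact: leq_batch_start.
Qed.

(** * Randomized predictors *)

Section randomized_predictors.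
Context {R : realType} {dX} {X : measurableType dX} {K : nat}.
Context {dT} {Theta : measurableType dT}.
Local Notation action := 'I_K.+1.
Variables (nu : probability X R) (p : R.-pker (X * action) ~> R).
Hypothesis p_cost : forall xa, p xa [set c | -1 <= c <= 0] = 1%E.
Variable f : Theta -> X -> action.
Hypothesis mf : measurable_fun [set: Theta * X] (fun z => f z.1 z.2).

Let indic t : @policy R dX X K := indicator_policy (f t).

Let mft t : measurable_fun setT (f t).
Proof. exact: (measurable_fun_pair2 t mf). Qed.

Let indicP t : is_policy (indic t).
Proof. exact: indicator_policyP. Qed.

Lemma measurable_indicator_policy :
  measurable_fun [set: Theta * (X * action)] (fun v => indic v.1 v.2.1 v.2.2).
Proof.
have m : measurable_fun [set: Theta * X * action] (fun v => indic v.1.1 v.1.2 v.2).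
  apply: measurable_ordinal_pairP => a.
  have ma : measurable_fun [set: action] (fun b => (b == a)%:R : R) by [].
  exact: (measurableT_comp ma mf).
have m2 : measurable_fun [set: Theta * (X * action)]
    (fun v => (v.1, v.2.1, v.2.2)).
  apply: measurable_fun_pair; last exact: (measurableT_comp measurable_snd).
  apply: measurable_fun_pair => //.
  exact: (measurableT_comp measurable_fst).
exact: (measurableT_comp m m2).
Qed.

Lemma policy_loss_indicator t x : policy_loss p (indic t) x = loss p (x, f t x).
Proof.
rewrite /policy_loss (bigD1 (f t x))//= /indic /indicator_policy eqxx mul1r.
by rewrite big1 ?addr0// => a ax; rewrite eq_sym (negbTE ax) mul0r.
Qed.

Let mloss : measurable_fun [set: Theta * X] (fun v => (loss p (v.2, f v.1 v.2))%:E).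
Proof.
apply/measurable_EFinP.
have m : measurable_fun [set: Theta * X] (fun v => (v.2, f v.1 v.2)).
  exact: measurable_fun_pair.
exact: (measurableT_comp (measurable_loss p) m).
Qed.

Let mloss0 v : (0 <= (loss p (v.2, f v.1 v.2))%:E)%E.
Proof. by rewrite lee_fin loss_ge0. Qed.

Let riskE_indic t :
  ((risk nu p (indic t))%:E = - \int[nu]_x (loss p (x, f t x))%:E)%E.
Proof.
rewrite riskE//; congr oppe; apply: eq_integral => x _.
by rewrite policy_loss_indicator.
Qed.

Lemma measurable_risk_indicator :
  measurable_fun setT (fun t => risk nu p (indic t)).
Proof.
apply/measurable_EFinP.
rewrite (_ : EFin \o _ =
    fun t => (- fubini_F nu (fun v => (loss p (v.2, f v.1 v.2))%:E) t)%E); last first.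
  by apply/funext => t; rewrite /= riskE_indic.
by apply: measurableT_comp => //; exact: measurable_fun_fubini_tonelli_F.
Qed.

Lemma normr_risk_le1 q : is_policy q -> `|risk nu p q| <= 1.
Proof.
move=> Hq; rewrite -lee_fin -[X in (X <= _)%E]/(`|(risk nu p q)%:E|%E) riskE//.
rewrite abseN gee0_abs; last first.
  by apply: integral_ge0 => x _; rewrite lee_fin policy_loss_ge0.
rewrite -[leRHS](probability_setT nu) -[leRHS]mul1e -integral_cst//.
apply: ge0_le_integral => //.
- by move=> x _; rewrite lee_fin policy_loss_ge0.
- by apply/measurable_EFinP; exact: measurable_policy_loss.
- by move=> x _; rewrite lee_fin policy_loss_le1.
Qed.

Variable Q : probability Theta R.

Let mindic x a : measurable_fun setT (fun t => (f t x == a)%:R : R).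
Proof. exact: (measurable_fun_pair1 (x, a) measurable_indicator_policy). Qed.

Lemma integral_indicator_policy x a :
  (\int[Q]_t (indic t x a)%:E = (predictor_policy f Q x a)%:E)%E.
Proof.
rewrite /predictor_policy /Rintegral fineK//; apply: integrable_fin_num => //.
apply: (@integrable_bounded _ _ _ _ _ 1); first exact: mindic.
by move=> t; rewrite ger0_norm// lern1 leq_b1.
Qed.

Lemma predictor_policyP : is_policy (predictor_policy f Q).
Proof.
split=> [a|x a|x].
- rewrite (_ : _ ^~ a = fine \o
      fubini_G Q (fun v => (indic v.1 v.2 a)%:E)); last first.
    by apply/funext => x; rewrite /= /fubini_G/= integral_indicator_policy.
  apply: measurableT_comp => //; apply: measurable_fun_fubini_tonelli_G; last first.
    by move=> v; rewrite lee_fin.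
  apply/measurable_EFinP.
  have ma : measurable_fun [set: action] (fun b => (b == a)%:R : R) by [].
  exact: (measurableT_comp ma mf).
- by rewrite -lee_fin -integral_indicator_policy integral_ge0// => t _; rewrite lee_fin.
- apply: EFin_inj; rewrite -sumEFin.
  under eq_bigr do rewrite -integral_indicator_policy.
  rewrite -ge0_integral_sum//; last 2 first.
  + by move=> a; apply/measurable_EFinP; exact: mindic.
  + by move=> a t _; rewrite lee_fin.
  rewrite -[RHS](probability_setT Q) -[RHS]mul1e -integral_cst//.
  apply: eq_integral => t _; rewrite sumEFin.
  by have [_ _ ->] := indicP t.
Qed.

(** Risk is linear in the policy, so Tonelli exchanges the draw of t with the draw of the
    context. *)
Lemma integral_risk_indicator :
  (\int[Q]_t (risk nu p (indic t))%:E = (risk nu p (predictor_policy f Q))%:E)%E.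
Proof.
under eq_integral do rewrite riskE_indic.
rewrite integral_ge0N; last first.
  by move=> t _; apply: integral_ge0 => x _; rewrite lee_fin loss_ge0.
rewrite riskE//; last exact: predictor_policyP.
congr oppe; rewrite (fubini_tonelli (fun v => (loss p (v.2, f v.1 v.2))%:E))//=.
apply: eq_integral => x _; rewrite /policy_loss -sumEFin.
under eq_bigr do rewrite EFinM -integral_indicator_policy muleC.
under eq_bigr => a _.
  rewrite -ge0_integralZl; [|by []|..].
  - over.
  - by apply/measurable_EFinP; exact: mindic.
  - by move=> t _; rewrite lee_fin.
  - by rewrite lee_fin loss_ge0.
rewrite -ge0_integral_sum//; last 2 first.
- move=> a; apply: measurable_funeM; apply/measurable_EFinP; exact: mindic.
- by move=> a t _; rewrite mule_ge0// lee_fin ?loss_ge0.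
apply: eq_integral => t _; rewrite -policy_loss_indicator /policy_loss -sumEFin.
by apply: eq_bigr => a _; rewrite -EFinM mulrC.
Qed.

End randomized_predictors.

(** * The PAC-Bayes bound *)

Section pac_bayes.
Context {R : realType} {dX} {X : measurableType dX} {K : nat}.
Local Notation action := 'I_K.+1.
Variables (nu : probability X R) (p : R.-pker (X * action) ~> R).
Hypothesis p_cost : forall xa, p xa [set c | -1 <= c <= 0] = 1%E.
Context {dO} {Omega : measurableType dO}.
Variables (Pr : probability Omega R) (pi0 : R.-pker X ~> action).
Variables (n : nat -> nat) (n_gt0 : forall k, (0 < n k)%N).
Variables (Alg : sequential_algorithm R X K n) (Z : nat -> Omega -> X * action * R).
Hypothesis mZ : forall i, measurable_fun setT (Z i).
Local Notation pi_ := (behavior_policy Z pi0 Alg).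
Hypothesis sampling : sequential_sampling n Z Pr nu p pi_.
Context {dT} {Theta : measurableType dT}.
Variable f : Theta -> X -> action.
Hypothesis mf : measurable_fun [set: Theta * X] (fun z => f z.1 z.2).
Variables (P : probability Theta R) (lambda : R).
Hypothesis lambda01 : 0 < lambda < 1.

Let indic t : @policy R dX X K := indicator_policy (f t).

(** The increment X_i(t), with the sample as a free argument so that it can be integrated against
    its conditional law. *)
Definition sample_log_weight (k : nat) (t : Theta) (w : Omega)
    (z : X * action * R) : R :=
  lambda * (risk nu p (indic t) - risk nu p (pi_ k w)) +
  log_weight lambda (pi_ k w z.1.1 z.1.2) (indic t z.1.1 z.1.2) z.2.

Definition batch_log_weight (k : nat) (t : Theta) (w : Omega) : R :=
  \sum_(j < k.+1) \sum_(batch_start n j <= i < batch_start n j.+1)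
    sample_log_weight j t w (Z i w).

Let mf_indic t : measurable_fun setT (f t).
Proof. exact: (measurable_fun_pair2 t mf). Qed.

Let measurable_risk_behavior i k : (batch_start n k <= i)%N ->
  measurable_fun [set: history Z i] (fun w => risk nu p (pi_ k w)).
Proof.
move=> ki; have [alpha alphaE] := behavior_kernel pi0 Alg Z ki.
apply/measurable_EFinP.
pose h (v : history Z i * X) := (\sum_a fine (alpha v [set a]) * loss p (v.2, a))%:E.
rewrite (_ : EFin \o _ = fun w => (- fubini_F nu h w)%E); last first.
  apply/funext => w; rewrite /= riskE//; last exact: is_policy_behavior.
  congr oppe; apply: eq_integral => x _; rewrite /h /policy_loss; congr EFin.
  by apply: eq_bigr => a _; rewrite alphaE.
apply: measurableT_comp => //; apply: measurable_fun_fubini_tonelli_F; last first.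
  move=> v; rewrite lee_fin sumr_ge0// => a _.
  by rewrite mulr_ge0 ?loss_ge0// fine_ge0.
apply/measurable_EFinP; apply: measurable_sum => a; apply: measurable_funM.
  apply: measurableT_comp => //; exact: measurable_kernel.
exact: (measurableT_comp (measurable_fun_pair1 a (measurable_loss p)) measurable_snd).
Qed.

Let measurable_behavior i k : (batch_start n k <= i)%N ->
  measurable_fun [set: history Z i * (X * action)]
    (fun v => pi_ k v.1 v.2.1 v.2.2).
Proof.
move=> ki; have [alpha alphaE] := behavior_kernel pi0 Alg Z ki.
have m : measurable_fun [set: history Z i * X * action]
    (fun v => fine (alpha v.1 [set v.2])).
  apply: measurable_ordinal_pairP => a; apply: measurableT_comp => //.
  exact: (measurable_kernel alpha [set a]).
have m2 : measurable_fun [set: history Z i * (X * action)]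
    (fun v => (v.1, v.2.1, v.2.2)).
  apply: measurable_fun_pair; last exact: (measurableT_comp measurable_snd).
  apply: measurable_fun_pair => //.
  exact: (measurableT_comp measurable_fst).
rewrite (_ : (fun v => _) = fun v : history Z i * (X * action) =>
    fine (alpha (v.1, v.2.1) [set v.2.2])).
  exact: (measurableT_comp m m2).
by apply/funext => v; rewrite alphaE.
Qed.

Let measurable_sample_log_weight i k : (batch_start n k <= i)%N ->
  measurable_fun [set: Theta * history Z i * (X * action * R)]
    (fun v => sample_log_weight k v.1.1 v.1.2 v.2).
Proof.
move=> ki.
have m11 : measurable_fun [set: Theta * history Z i * (X * action * R)]
    (fun v => v.1.1) by exact: (measurableT_comp measurable_fst measurable_fst).
have m12 : measurable_fun [set: Theta * history Z i * (X * action * R)]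
    (fun v => v.1.2) by exact: (measurableT_comp measurable_snd measurable_fst).
have m21 : measurable_fun [set: Theta * history Z i * (X * action * R)]
    (fun v => v.2.1) by exact: (measurableT_comp measurable_fst measurable_snd).
have m22 : measurable_fun [set: Theta * history Z i * (X * action * R)]
    (fun v => v.2.2) by exact: (measurableT_comp measurable_snd measurable_snd).
apply: measurable_funD.
  apply: measurable_funM => //; apply: measurable_funB.
    exact: (measurableT_comp (measurable_risk_indicator nu p_cost mf) m11).
  exact: (measurableT_comp (measurable_risk_behavior ki) m12).
apply: measurable_log_weight => //.
- exact: (measurableT_comp (measurable_behavior ki) (measurable_fun_pair m12 m21)).
- exact: (measurableT_comp (measurable_indicator_policy mf)
    (measurable_fun_pair m11 m21)).
Qed.

Lemma ville_batch_log_weight (a : R) : 0 < a ->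
  exists E, [/\ measurable E, ((1 - a^-1)%:E <= Pr E)%E &
    forall w, E w -> forall k,
      (\int[P]_t (expR (batch_log_weight k t w))%:E <= a%:E)%E].
Proof.
move=> a0.
have /choice[b bP] := batch_index n_gt0.
have bs i : (batch_start n (b i) <= i)%N by have /andP[] := bP i.
pose alpha i := projT1 (cid (behavior_kernel pi0 Alg Z (bs i))).
have alphaP i w x c : pi_ (b i) w x c = fine (alpha i (w, x) [set c]).
  exact: (projT2 (cid (behavior_kernel pi0 Alg Z (bs i)))).
pose kappa i : R.-pker (history Z i) ~> (X * action * R)%type :=
  triple_kernel nu p (alpha i).
pose y i (v : Theta * Omega * (X * action * R)) :=
  expR (sample_log_weight (b i) v.1.1 v.1.2 v.2).
pose M i (v : Theta * Omega) := \prod_(l < i) y l (v, Z l v.2).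
have y0 i v : 0 <= y i v by exact: expR_ge0.
have my i : measurable_fun [set: Theta * history Z i * (X * action * R)] (y i).
  apply: measurableT_comp => //; exact: measurable_sample_log_weight.
have mM i : measurable_fun [set: Theta * history Z i] (M i).
  apply: measurable_prod => l _.
  have ml : measurable_fun setT (fun w : history Z i => w : history Z l).
    apply: measurable_to_history => m lm; apply: measurable_history_coord.
    exact: ltn_trans lm (ltn_ord l).
  have m : measurable_fun [set: Theta * history Z i]
      (fun v => (v.1, (v.2 : history Z l), Z l v.2)).
    apply: measurable_fun_pair.
      apply: measurable_fun_pair => //; exact: (measurableT_comp ml measurable_snd).
    have mZl := @measurable_history_coord _ _ _ _ Z i l (ltn_ord l).
    exact: (measurableT_comp mZl measurable_snd).
  exact: (measurableT_comp (my l) m).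
have [E [mE PE EV]] : exists E, [/\ measurable E, ((1 - a^-1)%:E <= Pr E)%E &
    forall w, E w -> forall i, (\int[P]_t (M i (t, w))%:E <= a%:E)%E].
  apply: (@mixture_ville _ _ _ _ _ _ _ Pr P Z mZ kappa _ M y) => //.
  - by move=> i A B; exact: sampling_rect.
  - by move=> i v; exact: prodr_ge0.
  - by move=> v; rewrite /M big_ord0.
  - by move=> i t w; rewrite /M big_ord_recr.
  - move=> i t w; rewrite integral_triple_kernel//; last 2 first.
    + by move=> z; rewrite lee_fin.
    + apply/measurable_EFinP.
      exact: (@measurable_fun_pair2 _ _ _ (Theta * history Z i)%type _ _ _ (t, w) (my i)).
    have := @integral_expR_excess _ _ _ _ nu p p_cost lambda (pi_ (b i) w) (f t)
      lambda01 (is_policy_behavior pi0 Alg Z (b i) w) (mf_indic t).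
    rewrite (_ : (\int[nu]_x _)%E = (\int[nu]_x (\sum_a
      (fine (alpha i (w, x) [set a]))%:E *
      \int[p (x, a)]_c (y i (t, w, (x, a, c)))%:E))%E)//.
    by apply: eq_integral => x _; apply: eq_bigr => c _; rewrite -alphaP.
exists E; split => // w /EV wM k.
(* At the end of batch k the product of all factors so far is the exponential of the double sum. *)
rewrite (_ : (fun t => _) = fun t => (M (batch_start n k.+1) (t, w))%:E)//.
apply/funext => t; congr EFin.
rewrite /batch_log_weight -(sum_batches (b := b)
  (fun j i => sample_log_weight j t w (Z i w)))//.
by rewrite expR_sum.
Qed.

(** For a fixed outcome w, the sum is affine in the risk and the indicators of the predictor t, with
    coefficients free of t. Averaging over Q therefore replaces them by the risk and the
    probabilities of the mixture policy. *)
Lemma integral_batch_log_weight (Q : probability Theta R) k w :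
  let N := batch_start n k.+1 in
  Q.-integrable setT (fun t => (batch_log_weight k t w)%:E) /\
  (\int[Q]_t (batch_log_weight k t w)%:E =
   (lambda * N%:R * (risk nu p (predictor_policy f Q)
      - \sum_(j < k.+1) (n j)%:R / N%:R * risk nu p (pi_ j w)
      - adj_ls_risk n Z pi_ lambda k w (predictor_policy f Q)
      - adj_correction n Z lambda k w))%:E)%E.
Proof.
move=> N; have /andP[l0 _] := lambda01.
(* Integrability and value travel together, since additivity of the integral needs the former. *)
pose has_mean (g : Theta -> R) (v : R) :=
  Q.-integrable setT (EFin \o g) /\ (\int[Q]_t (g t)%:E = v%:E)%E.
have meanD g1 g2 v1 v2 : has_mean g1 v1 -> has_mean g2 v2 ->
    has_mean (fun t => g1 t + g2 t) (v1 + v2).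
  move=> [i1 e1] [i2 e2]; split; first exact: (integrableD measurableT i1 i2).
  under eq_integral do rewrite EFinD.
  by rewrite integralD// e1 e2.
have meanZ g v c : has_mean g v -> has_mean (fun t => c * g t) (c * v).
  move=> [i1 e1]; split; first exact: (integrableZl measurableT c i1).
  under eq_integral do rewrite EFinM.
  by rewrite integralZl// e1.
have meanC c : has_mean (cst c) c.
  split; first exact: finite_measure_integrable_cst.
  rewrite -[LHS]/(\int[Q]_t cst c%:E t)%E integral_cst// -[RHS]mule1; congr (_ * _)%E.
  exact: probability_setT.
have mean_sum I (s : seq I) (g : I -> Theta -> R) (v : I -> R) :
    (forall i, has_mean (g i) (v i)) ->
    has_mean (fun t => \sum_(i <- s) g i t) (\sum_(i <- s) v i).
  move=> gv; elim: s => [|i s IHs].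
    rewrite big_nil (_ : (fun t => _) = cst 0)//.
    by apply/funext => t; rewrite big_nil.
  rewrite big_cons (_ : (fun t => _) = fun t => g i t + \sum_(i <- s) g i t).
    exact: meanD.
  by apply/funext => t; rewrite big_cons.
have mean_risk : has_mean (fun t => risk nu p (indic t))
    (risk nu p (predictor_policy f Q)).
  split; last exact: (integral_risk_indicator nu p_cost mf Q).
  apply: (@integrable_bounded _ _ _ _ _ 1).
    exact: (measurable_risk_indicator nu p_cost mf).
  by move=> t; apply: normr_risk_le1 => //; exact: indicator_policyP.
have mean_indic x a : has_mean (fun t => indic t x a) (predictor_policy f Q x a).
  split; last exact: (integral_indicator_policy mf).
  apply: (@integrable_bounded _ _ _ _ _ 1).
    exact: (measurable_fun_pair1 (x, a) (measurable_indicator_policy mf)).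
  by move=> t; rewrite ger0_norm// lern1 leq_b1.
pose L j i := ln (1 - lambda * (Z i w).2 /
  (pi_ j w (Z i w).1.1 (Z i w).1.2 * (1 + lambda * (Z i w).2))).
pose D i := ln (1 + lambda * (Z i w).2)^-1.
pose q i := predictor_policy f Q (Z i w).1.1 (Z i w).1.2.
(* The claimed value is put in the shape of [batch_log_weight], each function of t being replaced by
   its mean; batch j contributes [n j] copies of its risk difference. *)
have -> : lambda * N%:R * (risk nu p (predictor_policy f Q)
      - \sum_(j < k.+1) (n j)%:R / N%:R * risk nu p (pi_ j w)
      - adj_ls_risk n Z pi_ lambda k w (predictor_policy f Q)
      - adj_correction n Z lambda k w) =
    \sum_(j < k.+1) \sum_(batch_start n j <= i < batch_start n j.+1)
      (lambda * (risk nu p (predictor_policy f Q) + - risk nu p (pi_ j w)) +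
       (L j i * q i + - D i)).
  have -> : adj_ls_risk n Z pi_ lambda k w (predictor_policy f Q) =
      - (N%:R^-1 * (lambda^-1 * \sum_(j < k.+1)
        \sum_(batch_start n j <= i < batch_start n j.+1) L j i * q i)).
    rewrite /adj_ls_risk [X in _ = - (_ * X)]mulr_sumr; congr (- (_ * _)); apply: eq_bigr => j _.
    rewrite mulr_sumr; apply: eq_bigr => i _; rewrite /L /q.
    by case: (Z i w) => [[x a] c] /=; ring.
  have -> : adj_correction n Z lambda k w =
      N%:R^-1 * (lambda^-1 * \sum_(j < k.+1)
        \sum_(batch_start n j <= i < batch_start n j.+1) D i).
    rewrite /adj_correction [X in _ = _ * X]mulr_sumr; congr (_ * _); apply: eq_bigr => j _.
    by rewrite mulr_sumr.
  have N0 : N%:R != 0 :> R.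
    rewrite pnatr_eq0 -lt0n /N batch_startS (leq_trans (n_gt0 k))//.
    exact: leq_addl.
  have nE j : (batch_start n j.+1 - batch_start n j)%N = n j.
    by rewrite batch_startS addKn.
  under [RHS]eq_bigr => j _.
    rewrite !big_split/= sumrN sumr_const_nat nE -mulr_natl; over.
  rewrite !big_split/= sumrN.
  have -> : \sum_(j < k.+1) (n j)%:R *
      (lambda * (risk nu p (predictor_policy f Q) + - risk nu p (pi_ j w))) =
      lambda * N%:R * (risk nu p (predictor_policy f Q) -
        \sum_(j < k.+1) (n j)%:R / N%:R * risk nu p (pi_ j w)).
    rewrite mulrBr mulr_sumr.
    have EN : N%:R = \sum_(j < k.+1) (n j)%:R :> R by rewrite -natr_sum.
    rewrite [X in lambda * X * _ - _]EN mulr_sumr mulr_suml -sumrB.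
    by apply: eq_bigr => j _; field.
  by field; rewrite N0 gt_eqF.
apply: (mean_sum) => j; apply: (mean_sum) => i.
apply: (meanD); first by apply: (meanZ); apply: (meanD) => //; exact: meanC.
apply: (meanD); last exact: meanC.
rewrite (_ : (fun t => _) = fun t => L j i * indic t (Z i w).1.1 (Z i w).1.2).
  exact: meanZ.
by apply/funext => t; rewrite mulrC.
Qed.

Theorem pac_bayes (delta : R) (delta01 : 0 < delta <= 1) :
  let N k := batch_start n k.+1 in
  exists E : set Omega,
    [/\ measurable E, ((1 - delta)%:E <= Pr E)%E &
      forall w, E w -> forall (k : nat) (Q : probability Theta R),
        ((risk nu p (predictor_policy f Q)
          - \sum_(j < k.+1) (n j)%:R / (N k)%:R * risk nu p (pi_ j w))%:E
         <= (adj_ls_risk n Z pi_ lambda k w (predictor_policy f Q))%:E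
            + (adj_correction n Z lambda k w)%:E
            + (KL Q P + (ln delta^-1)%:E) * ((lambda * (N k)%:R)^-1)%:E)%E].
Proof.
have /andP[d0 d1] := delta01; have /andP[l0 l1] := lambda01.
(* The level 1 / delta turns the probability 1 - a^-1 into 1 - delta. *)
have [|E [mE PE EV]] := @ville_batch_log_weight delta^-1; first by rewrite invr_gt0.
exists E; split => //; first by rewrite -{1}[delta]invrK.
move=> w /EV wE k Q; have {wE} := wE k.
have [iS ES] := integral_batch_log_weight Q k w.
set S := batch_log_weight k ^~ w in iS ES * => PS.
set N := batch_start n k.+1 in ES *.
set A := adj_ls_risk _ _ _ _ _ _ _ in ES *.
set C := adj_correction _ _ _ _ _ in ES *.
have N0 : 0 < lambda * N%:R.
  rewrite mulr_gt0// ltr0n /N batch_startS (leq_trans (n_gt0 k))//.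
  exact: leq_addl.
have mS : measurable_fun setT S by exact/measurable_EFinP/(measurable_int _ iS).
(* The shift by ln delta normalises the exponential moment under [P] from 1 / delta to 1, and
   becomes the log (1 / delta) term of the bound. *)
have : (\int[Q]_t (S t + ln delta)%:E <= KL Q P)%E.
  apply: donsker_varadhan.
  - exact: measurable_funD.
  - rewrite (_ : EFin \o _ = (fun t => (S t)%:E) \+ cst (ln delta)%:E)%E//.
    by apply: integrableD => //; exact: finite_measure_integrable_cst.
  - under eq_integral do rewrite expRD lnK ?posrE// EFinM.
    rewrite ge0_integralZr; [|by []|..].
    + apply: (@le_trans _ _ (delta^-1%:E * delta%:E)%E).
        by rewrite lee_wpmul2r// lee_fin ltW.
      by rewrite -EFinM mulVf// gt_eqF.
    + by apply/measurable_EFinP; exact: measurableT_comp.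
    + by move=> t _; rewrite lee_fin expR_ge0.
    + by rewrite lee_fin ltW.
under eq_integral do rewrite EFinD.
rewrite integralD//=; last exact: finite_measure_integrable_cst.
rewrite ES integral_cst//.
have -> : ((ln delta)%:E * Q setT)%E = (ln delta)%:E.
  by rewrite [X in (_ * X)%E]probability_setT mule1.
(* The value -oo contradicts the inequality just obtained, whose left side is finite; for +oo the
   right side of the goal is +oo because lambda N > 0. *)
case: (KL Q P) => [r| |] //=; last first.
  move=> _; rewrite addye// mulyr gtr0_sg ?invr_gt0// mul1e.
  by rewrite addey// leey.
move=> h; rewrite [leRHS](_ : _ = (A + C + (r + ln delta^-1) / (lambda * N%:R))%:E)//.
rewrite lee_fin lnV ?posrE//; set V := (X in X <= _).
have {}h : lambda * N%:R * (V - A - C) + ln delta <= r.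
  by rewrite -lee_fin; exact: h.
suff : V - A - C <= (r - ln delta) / (lambda * N%:R).
  by move=> VAC; rewrite -addrA -lerBlDl -lerBlDl.
by rewrite ler_pdivlMr// mulrC lerBrDr.
Qed.

End pac_bayes.

Theorem theorem4p1 (R : realType) (d K : nat)
    (X : set 'rV[R]_d) (cX : compact X) (X0 : X !=set0)
    (nu : probability (context X0) R)
    (p : R.-pker (context X0 * 'I_K.+1) ~> R)
    (p_cost : forall xa, p xa [set c | -1 <= c <= 0] = 1%E)
    (dO : measure_display) (Omega : measurableType dO)
    (Pr : probability Omega R)
    (pi0 : R.-pker (context X0) ~> 'I_K.+1)
    (n : nat -> nat) (n_gt0 : forall k, (0 < n k)%N)
    (Alg : sequential_algorithm R (context X0) K n)
    (Z : nat -> {RV Pr >-> (context X0 * 'I_K.+1 * R)%type})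
    (sampling : sequential_sampling n Z Pr nu p (behavior_policy Z pi0 Alg))
    (dT : measure_display) (Theta : measurableType dT)
    (f : Theta -> context X0 -> 'I_K.+1)
    (mf : measurable_fun [set: Theta * context X0] (fun z => f z.1 z.2))
    (P : probability Theta R)
    (lambda : R) (lambda01 : 0 < lambda < 1)
    (delta : R) (delta01 : 0 < delta <= 1) :
  let pi_ := behavior_policy Z pi0 Alg in
  let N k := batch_start n k.+1 in
  exists E : set Omega,
    [/\ measurable E, ((1 - delta)%:E <= Pr E)%E &
      forall w, E w -> forall (k : nat) (Q : probability Theta R),
        ((risk nu p (predictor_policy f Q)
          - \sum_(j < k.+1) (n j)%:R / (N k)%:R * risk nu p (pi_ j w))%:E
         <= (adj_ls_risk n Z pi_ lambda k w (predictor_policy f Q))%:E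
            + (adj_correction n Z lambda k w)%:E
            + (KL Q P + (ln delta^-1)%:E) * ((lambda * (N k)%:R)^-1)%:E)%E].
Proof.
exact: (pac_bayes p_cost n_gt0 (fun i => @measurable_funP _ _ _ _ setT (Z i))
  sampling mf P lambda01 delta01).
Qed.
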